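(* Let $\theta=(\theta_1,\dots,\theta_d)\in\mathbb{R}^d$ be local coordinates on a differentiable manifold of stable stochastic linear systems $[\{H_i\},R]$ with a common McMillan degree. For each system let $\Gamma_i=E(y_t y_{t+i}^T)$, $i=0,1,2,\dots$, be the covariances of the stochastic process $\{y_t\}$ generated by the system, and let $U(z)=\sum_{i=0}^{\infty}\Gamma_i z^{-i}$. Then the stochastic Riemannian metric tensor $G=(g_{ij})$ induced by the inner product $\langle s_1,s_2\rangle=\mathrm{tr}\big[\sum_{i=0}^{\infty}\Gamma_i^{1}(\Gamma_i^{2})^T\big]$ is given by $$g_{ij}=\frac{1}{2\pi\sqrt{-1}}\oint_C \mathrm{tr}\left[\frac{\partial U(z)}{\partial\theta_i}\,\frac{\partial U^T(z^{-1})}{\partial\theta_j}\right]z^{-1}\,dz,\qquad i,j=1,\dots,d,$$ where $C$ is the unit circle centered at the origin of the complex plane (traversed counterclockwise), $\mathrm{tr}$ stands for trace and the superscript $T$ for matrix transposition.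
   Context: A stochastic linear system $[\{H_i\},R]$ is given by real $m\times m$ Markov parameters $\{H_i\}_{i\ge 0}$ with rational transfer function $H(z)=\sum_{i\ge0}H_iz^{-i}$, and a symmetric positive definite $m\times m$ matrix $R$. It is stable if all poles of $H(z)$ lie in the open unit disc. Its output is the stationary zero-mean process $y_t=\sum_{i\ge 0}H_i\varepsilon_{t-i}$, where $\{\varepsilon_t\}$ is an unobserved zero-mean Gaussian white noise with covariance $R$. The McMillan degree is the rank of the infinite block Hankel matrix with $(i,j)$ block $H_{i+j-1}$, $i,j\ge 1$. $U^T(z^{-1})$ denotes the transpose of $U$ evaluated at $z^{-1}$. The systems depend smoothly on $\theta$ (the coefficients of the rational entries of $H(z)$ and the entries of $R$ are smooth functions of $\theta$). The metric is that of the covariance system, i.e. the system whose Markov parameters are $\{\Gamma_i\}_{i\ge 0}$. For a smooth curve of systems, the tangent vector $s'$ is represented by the sequence of derivatives of the $\Gamma_i$ along the curve, and in the inner product $\Gamma_i^1,\Gamma_i^2$ denote the members of these sequences for the two tangent vectors. The metric tensor $G$ is the symmetric $d\times d$ matrix such that $\theta_1'^{\,T}G\,\theta_2'=\langle s_1',s_2'\rangle$ for any two curves through the system with coordinate derivatives $\theta_1',\theta_2'\in\mathbb{R}^d$ and tangent vectors $s_1',s_2'$. *)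

(* Defs.v *)
From HB Require Import structures.
From mathcomp Require Import all_boot all_order all_algebra.
From mathcomp Require Import all_classical all_reals all_analysis.
From mathcomp Require Import complex.

Set Implicit Arguments.
Unset Strict Implicit.
Unset Printing Implicit Defensive.

Import Order.TTheory GRing.Theory Num.Theory.
Import numFieldNormedType.Exports.

Local Open Scope classical_set_scope.
Local Open Scope complex_scope.
Local Open Scope ring_scope.

Section smoothness.
Context {R : realType} {d : nat}.

(* Iterated partial derivatives up to order k exist and are continuous on D,
   which is meant to be open. *)
Fixpoint class_C (k : nat) (D : set 'rV[R]_d) (f : 'rV[R]_d -> R) : Prop :=
  (forall x, D x -> {for x, continuous f}) /\
  match k with
  | 0 => True
  | k'.+1 => forall i : 'I_d,
      (forall x, D x -> derivable f x (delta_mx 0 i)) /\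
      class_C k' D (fun x => 'D_(delta_mx 0 i) f x)
  end.

Definition smooth_on (D : set 'rV[R]_d) (f : 'rV[R]_d -> R) :=
  forall k, class_C k D f.

Definition smooth_curve_through (D : set 'rV[R]_d) (x : 'rV[R]_d)
    (c : R -> 'rV[R]_d) :=
  c 0 = x /\
  \forall t \near (0 : R), D (c t) /\ forall k, derivable (c^`(k))%classic t 1.

End smoothness.

Section complex_calculus.
Context {R : realType}.

(* Partial derivative of a complex-valued function of real variables, taken on
   the real and imaginary parts since R[i] has no normed R-module structure
   in the library. *)
Definition derivableC {d : nat} (i : 'I_d) (f : 'rV[R]_d -> R[i])
    (x : 'rV[R]_d) :=
  derivable (fun y => complex.Re (f y)) x (delta_mx 0 i) /\
  derivable (fun y => complex.Im (f y)) x (delta_mx 0 i).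

Definition partialC {d : nat} (i : 'I_d) (f : 'rV[R]_d -> R[i])
    (x : 'rV[R]_d) : R[i] :=
  'D_(delta_mx 0 i) (fun y => complex.Re (f y)) x +i*
  'D_(delta_mx 0 i) (fun y => complex.Im (f y)) x.

Definition partial_mx {d m : nat} (i : 'I_d) (F : 'rV[R]_d -> 'M[R[i]]_m)
    (x : 'rV[R]_d) : 'M[R[i]]_m :=
  \matrix_(a, b) partialC i (fun y => F y a b) x.

Definition expi (t : R) : R[i] := cos t +i* sin t.

(* f(z) dz pulled back by z = e^{it}, dz = i e^{it} dt *)
Definition circle_pullback (f : R[i] -> R[i]) (t : R) : R[i] :=
  f (expi t) * ('i%C * expi t).

Definition circle_integrable (f : R[i] -> R[i]) :=
  (@lebesgue_measure R).-integrable `[0, 2 * pi]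
    (EFin \o (fun t => complex.Re (circle_pullback f t))) /\
  (@lebesgue_measure R).-integrable `[0, 2 * pi]
    (EFin \o (fun t => complex.Im (circle_pullback f t))).

Definition circle_integral (f : R[i] -> R[i]) : R[i] :=
  (\int[@lebesgue_measure R]_(t in `[0, 2 * pi]) complex.Re (circle_pullback f t)) +i*
  (\int[@lebesgue_measure R]_(t in `[0, 2 * pi]) complex.Im (circle_pullback f t)).

(* Partial sums of \sum_i u_i z^{-i}. *)
Definition zseries (u : nat -> R) (z : R[i]) : nat -> R[i]^o :=
  series (fun i => (u i)%:C * z ^- i : R[i]^o).

End complex_calculus.

Section systems.
Context {R : realType} {m : nat}.

Record linear_system := LinearSystem {
  markov_param : nat -> 'M[R]_m ;
  noise_cov : 'M[R]_m }.

(* \sum_i H_i z^{-i} is, near infinity, the expansion of the matrix of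
   rational functions with entries num a b / den a b. *)
Definition has_transfer (H : nat -> 'M[R]_m) (num den : 'M[{poly R}]_m) :=
  forall a b, den a b != 0 /\
    exists r : R, forall z : R[i], r%:C < `|z| ->
      zseries (fun i => H i a b) z @ \oo -->
      ((map_poly (real_complex R) (num a b)).[z] /
       (map_poly (real_complex R) (den a b)).[z] : R[i]^o).

(* The gcd is divided out, so that z is a root of the denominator of an entry
   in lowest terms. *)
Definition is_pole (H : nat -> 'M[R]_m) (z : R[i]) :=
  exists num den, has_transfer H num den /\
    exists a b, root (map_poly (real_complex R)
      (den a b %/ gcdp (num a b) (den a b))) z.

Definition posdef (S : 'M[R]_m) :=
  S^T = S /\ forall x : 'rV[R]_m, x != 0 -> 0 < (x *m S *m x^T) 0 0.

Definition stochastic_linear_system (s : linear_system) :=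
  (exists num den, has_transfer (markov_param s) num den) /\ posdef (noise_cov s).

Definition stable (s : linear_system) :=
  forall z, is_pole (markov_param s) z -> `|z| < 1.

(* Indices start at 0, so the (i, j) block is H_{i+j+1}. *)
Definition hankel (H : nat -> 'M[R]_m) (k : nat) :=
  \mxblock_(i < k, j < k) H (i + j).+1.

(* The rank of the infinite matrix is the largest rank of its finite
   truncations. *)
Definition mcmillan_degree (s : linear_system) (n : nat) :=
  (forall k, (\rank (hankel (markov_param s) k) <= n)%N) /\
  exists k, \rank (hankel (markov_param s) k) = n.

(* Denominators are monic because the coefficients of a rational function are
   otherwise only defined up to a common factor; fractions need not be in
   lowest terms, since the reduced degrees of the entries may vary even when
   the McMillan degree does not. *)
Definition smooth_family {d : nat} (D : set 'rV[R]_d)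
    (s : 'rV[R]_d -> linear_system) :=
  (exists (N : nat) (num den : 'rV[R]_d -> 'M[{poly R}]_m),
    (forall x, D x -> has_transfer (markov_param (s x)) (num x) (den x) /\
       forall a b, [/\ den x a b \is monic, (size (num x a b) <= N)%N &
                       (size (den x a b) <= N)%N]) /\
    (forall a b k, smooth_on D (fun x => (num x a b)`_k) /\
                   smooth_on D (fun x => (den x a b)`_k))) /\
  forall a b, smooth_on D (fun x => noise_cov (s x) a b).

End systems.
Arguments linear_system : clear implicits.

Section processes.
Context {R : realType} {m : nat} {disp : measure_display}
  {T : measurableType disp} (P : probability T R).

(* normal_prob is the density-based law, hence the separate degenerate case. *)
Definition gaussian (X : T -> R) :=
  exists mu sigma : R, forall A : set R, measurable A ->
    P (X @^-1` A) = if sigma == 0 then \d_mu A else normal_prob mu sigma A.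

Definition gaussian_white_noise (S : 'M[R]_m)
    (eps : int -> 'I_m -> {RV P >-> R}) :=
  [/\ forall t a, ('E_P[eps t a] = 0)%E,
      forall s t a b, 'E_P[((eps s a : T -> R) \* (eps t b : T -> R))%R]%E =
                      (if s == t then S a b else 0)%:E &
      forall (n : nat) (t : 'I_n -> int) (c : 'I_n -> 'I_m -> R),
        gaussian (fun w => \sum_(k < n) \sum_(a < m) c k a * eps (t k) a w)].

(* y_t = \sum_{i >= 0} H_i eps_{t-i}, the series converging in mean square *)
Definition output_process (H : nat -> 'M[R]_m)
    (eps y : int -> 'I_m -> {RV P >-> R}) :=
  forall t a,
    'E_P[(fun w => (y t a w - \sum_(i < n) \sum_(b < m)
                     H i a b * eps (t - i%:Z) b w) ^+ 2)%R]%E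
    @[n --> \oo] --> 0%E.

(* E(y_t y_{t+i}^T) *)
Definition autocov (y : int -> 'I_m -> {RV P >-> R}) (t : int) (i : nat) :
    'M[R]_m :=
  \matrix_(a, b) fine 'E_P[((y t a : T -> R) \* (y (t + i%:Z) b : T -> R))%R]%E.

End processes.

Section metric.
Context {R : realType} {d m : nat}.
Implicit Types (D : set 'rV[R]_d) (x : 'rV[R]_d) (c : R -> 'rV[R]_d)
  (Gam : 'rV[R]_d -> nat -> 'M[R]_m) (s : nat -> 'M[R]_m).

Definition inner_partial s1 s2 : nat -> R :=
  series (fun i => \tr (s1 i *m (s2 i)^T)).

Definition tangent_vector Gam c s :=
  forall i, is_derive (0 : R) 1 (fun t => Gam (c t) i) (s i).

(* The tangent vectors s1, s2 are unique when they exist; their existence and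
   the convergence of <s1, s2> are part of the definition. *)
Definition metric_tensor D Gam x (G : 'M[R]_d) :=
  G^T = G /\
  forall c1 c2, smooth_curve_through D x c1 -> smooth_curve_through D x c2 ->
    exists s1 s2, [/\ tangent_vector Gam c1 s1, tangent_vector Gam c2 s2 &
      inner_partial s1 s2 @ \oo -->
        ((c1^`())%classic 0 *m G *m ((c2^`())%classic 0)^T) 0 0].

(* U(z) = \sum_i Gamma_i z^{-i} *)
Definition spectral_series Gam x (z : R[i]) : 'M[R[i]]_m :=
  \matrix_(a, b) limn (zseries (fun i => Gam x i a b) z).

Definition metric_integrand Gam x (i j : 'I_d) (z : R[i]) : R[i] :=
  \tr (partial_mx i (fun y => spectral_series Gam y z) x *m
       partial_mx j (fun y => (spectral_series Gam y z^-1)^T) x) * z^-1.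

End metric.

(* Main.v *)
Require Import Defs.
From HB Require Import structures.
From mathcomp Require Import all_boot all_order all_algebra.
From mathcomp Require Import all_classical all_reals all_analysis.
From mathcomp Require Import complex.
From mathcomp Require Import ring lra zify.

(** On the unit circle, [U] is a Fourier series with coefficients [Gamma_k],
    so the formula is Parseval's identity: the partial derivative of [U] along
    [theta_i] has the coefficients [d_i Gamma_k], and integrating the product
    of a series in [z] and a series in [z^-1] keeps the diagonal terms [\sum_k
    tr (d_i Gamma_k (d_j Gamma_k)^T)] only ([circle_parseval]). That sum is
    the inner product of the tangent vectors of two coordinate lines, and
    these determine the metric tensor ([metric_tensor_partials],
    [metric_tensor_unique]). What has to be justified is that everything may
    be differentiated termwise, for which the covariances and their difference
    quotients must decay geometrically, uniformly near the given system.

    At one system, stability makes the Markov parameters tend to zero: once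
    common factors are removed, an entry of the transfer function has its
    denominator roots in the open disc, and its Markov parameters satisfy the
    corresponding linear recurrence ([stable_markov_param_cvg0]). This
    argument does not extend to neighbouring systems, because the fractions
    that depend smoothly on the parameters need not be in lowest terms, and
    the reduced degrees may jump. The common McMillan degree [n] replaces it.
    An [n x n] minor of the Hankel matrix that is invertible at the given
    system stays invertible nearby, and determines the whole Hankel matrix,
    whose rank is [n] ([hankel_entry_factor]). Hence [H_{k+1} = C A^k B],
    where [A], [B] and [C] are rational functions of finitely many Markov
    parameters ([markov_realization]). The Markov parameters are
    differentiable functions of the parameters by recurrence on the
    coefficients of the fractions ([markov_param_differentiable]); so are [A],
    [B] and [C], and [A^k] tends to zero at the given system because it is
    [M^-1] times a shifted minor, whose entries are late Markov parameters;
    here [M] is the invertible minor ([state_matrix_pow]).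

    To pass from one system to a neighbourhood, a function [f] near a point
    [x] is measured by [|f x| + s Lip_x f], where [Lip_x f] is the Lipschitz
    constant at [x] over the ball of radius [s] ([lipnorm_le]). This norm is
    submultiplicative, it is close to [|f x|] when [s] is small and [f] is
    differentiable at [x], and a series whose norms are summable can be
    differentiated termwise at [x] ([lipnorm_le_series]). Some power of [A] is
    small at [x], so it has small norm, and the norms of all powers decay
    geometrically ([mx_powers_lipnorm]). The decay passes to the Markov
    parameters ([markov_param_lipnorm]), then to the covariances [Gamma_k =
    \sum_i H_i R H_{i+k}^T] ([autocov_series], [covariance_lipnorm]), and
    gives the termwise derivative of [U] ([spectral_series_partial]). *)

Import Order.TTheory GRing.Theory Num.Theory.
Import numFieldNormedType.Exports.

Set Implicit Arguments.
Unset Strict Implicit.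
Unset Printing Implicit Defensive.

Local Open Scope classical_set_scope.
Local Open Scope complex_scope.
Local Open Scope ring_scope.

(** * Gradients *)

Section gradients.
Context {R : realType} {d : nat}.
Implicit Types (f : 'rV[R]_d -> R) (x h : 'rV[R]_d) (g : 'I_d -> R).

Definition gradform g h : R := \sum_i h 0 i * g i.

Lemma gradform_linear g : linear (gradform g).
Proof.
move=> a u v; rewrite /gradform scaler_sumr -big_split /=.
by apply: eq_bigr => i _; rewrite !mxE mulrDl -mulrA.
Qed.

HB.instance Definition _ g :=
  GRing.isLinear.Build R 'rV[R]_d R _ (gradform g) (gradform_linear g).

Lemma normr_coord_le (n p : nat) (M : 'M[R]_(n, p)) i j : `|M i j| <= `|M|.
Proof. by rewrite [leRHS]/Num.Def.normr/= mx_normrE (le_bigmax _ _ (i, j)). Qed.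

Lemma gradform_norm_le g h : `|gradform g h| <= (\sum_i `|g i|) * `|h|.
Proof.
rewrite mulr_suml; apply: (le_trans (ler_norm_sum _ _ _)).
by apply: ler_sum => i _; rewrite normrM mulrC ler_wpM2l// normr_coord_le.
Qed.

Lemma gradform_continuous g : continuous (gradform g).
Proof.
apply/bounded_linear_continuous/linear_boundedP.
near=> r => h; apply: (le_trans (gradform_norm_le _ _)); exact: ler_wpM2r.
Unshelve. all: by end_near. Qed.

(** Differentiability in the form that survives passing to a sum of
    infinitely many functions: an explicit gradient and an explicit remainder. *)
Definition has_gradient f x g := forall e, 0 < e ->
  \forall h \near (0 : 'rV[R]_d),
    `|f (h + x) - f x - gradform g h| <= e * `|h|.

Lemma gradform_delta g i : gradform g (delta_mx 0 i) = g i.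
Proof.
rewrite /gradform (bigD1 i)//= big1 ?addr0 => [|j ji].
  by rewrite mxE !eqxx mul1r.
by rewrite mxE (negbTE ji) andbF mul0r.
Qed.

Lemma has_gradient_is_diff f x g : has_gradient f x g ->
  is_diff x f (gradform g).
Proof.
move=> fg.
have fE : f \o shift x = cst (f x) + gradform g +o_ (0 : 'rV[R]_d) id.
  apply: eqaddoE; rewrite [LHS](_ : _ = (cst (f x) + gradform g) +
    (fun h => f (h + x) - f x - gradform g h)); last first.
    by apply/funext => h /=; rewrite !fctE /=; ring.
  congr (_ + _); apply/eqoP => e e0; exact: fg.
have dE := diff_unique (@gradform_continuous g) fE.
apply: DiffDef => //; apply/diff_locallyP; rewrite dE; split => //.
exact: gradform_continuous.
Qed.

Lemma differentiable_has_gradient f x : differentiable f x ->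
  has_gradient f x (fun i => 'D_(delta_mx 0 i) f x).
Proof.
move=> df e e0.
have dE h : gradform (fun i => 'D_(delta_mx 0 i) f x) h = 'd f x h.
  rewrite [in RHS](row_sum_delta h) linear_sum; apply: eq_bigr => i _.
  by rewrite linearZ/= deriveE.
have [_ /eqaddoP/(_ _ e0)] := (diff_locallyP x f).1 df.
apply: filterS => h; rewrite dE /= !fctE /=.
by rewrite [X in `|X| <= _](_ : _ = f (h + x) - f x - 'd f x h)// opprD addrA.
Qed.

Lemma has_gradient_partial f x g i : has_gradient f x g ->
  derivable f x (delta_mx 0 i) /\ 'D_(delta_mx 0 i) f x = g i.
Proof.
move=> /has_gradient_is_diff fg; have df := @ex_diff _ _ _ _ _ _ _ fg.
by split; [exact: diff_derivable|rewrite deriveE// diff_val gradform_delta].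
Qed.

End gradients.

(** * Continuously differentiable functions *)

Section C1_functions.
Context {R : realType}.

Lemma is_derive_line {V W : normedModType R} (f : V -> W) (p v : V) (s : R) :
  derivable f (s *: v + p) v ->
  is_derive s 1 (fun u => f (u *: v + p)) ('D_v f (s *: v + p)).
Proof.
have E : (fun h : R => h^-1 *: (((fun u => f (u *: v + p)) \o shift s) (h *: (1 : R))
      - f (s *: v + p))) =
    (fun h => h^-1 *: ((f \o shift (s *: v + p)) (h *: v) - f (s *: v + p))).
  by apply/funext => h; rewrite /= -[h *: 1]/(h * 1) mulr1 scalerDl addrA.
by move=> df; split; rewrite /derivable /derive E.
Qed.

Lemma MVT_abs (g dg : R -> R) (r : R) :
  (forall s : R, `|s| <= `|r| -> is_derive s 1 g (dg s)) ->
  exists2 c, `|c| <= `|r| & g r - g 0 = dg c * r.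
Proof.
move=> gd.
have cont a b : (forall s, s \in `[a, b] -> `|s| <= `|r|) ->
    {within `[a, b], continuous g}.
  by move=> ab; apply: derivable_within_continuous => s /ab/gd sd; exact: (@ex_derive _ _ _ _ _ _ _ sd).
have [r0|r0] := leP 0 r.
- have H s : s \in `[0, r] -> `|s| <= `|r|.
    by rewrite in_itv/= => /andP[s0 sr]; rewrite !ger0_norm.
  have gd' s : s \in `]0, r[ -> is_derive s 1 g (dg s).
    by move=> /subset_itv_oo_cc/H; exact: gd.
  have [c /H cr] := MVT_segment r0 gd' (cont _ _ H).
  by rewrite subr0 => ?; exists c.
- have H s : s \in `[r, 0] -> `|s| <= `|r|.
    by rewrite in_itv/= => /andP[s0 sr]; rewrite (ltr0_norm r0) ler0_norm// lerN2.
  have gd' s : s \in `]r, 0[ -> is_derive s 1 g (dg s).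
    by move=> /subset_itv_oo_cc/H; exact: gd.
  have [c /H cr] := MVT_segment (ltW r0) gd' (cont _ _ H).
  rewrite sub0r mulrN => /(congr1 -%R); rewrite opprK opprB => ?.
  by exists c.
Qed.

(** Moving from [x] to [x + h] one coordinate at a time turns the increment
    into a sum of one-variable increments, to which the mean value theorem
    applies; continuity of the partial derivatives makes the error small. *)
Lemma class_C1_differentiable {d : nat} (D : set 'rV[R]_d) (f : 'rV[R]_d -> R) x :
  open D -> class_C 1 D f -> D x -> differentiable f x.
Proof.
move=> oD [_ df] Dx.
suff fg : has_gradient f x (fun i => 'D_(delta_mx 0 i) f x).
  exact: (@ex_diff _ _ _ _ _ _ _ (has_gradient_is_diff fg)).
move=> e e0; pose e' := e / d.+1%:R.
have e'0 : 0 < e' by rewrite divr_gt0.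
have near_x : \forall z \near x, D z /\ forall i : 'I_d,
    `|'D_(delta_mx 0 i) f x - 'D_(delta_mx 0 i) f z| <= e'.
  apply: filter_app (open_nbhs_nbhs (conj oD Dx)).
  have /filter_forall : forall i : 'I_d, \forall z \near x,
      `|'D_(delta_mx 0 i) f x - 'D_(delta_mx 0 i) f z| <= e'.
    move=> i; have /cvgrPdist_le := (df i).2.1 x Dx; exact.
  by apply: filterS => z ? ?; split.
case/nbhs_normP: near_x => r /= r0 Br.
apply/nbhs_normP; exists r => //= h; rewrite /ball_/= sub0r normrN => hr.
(* the point reached after the first [k] coordinates have been moved *)
pose p (k : nat) : 'rV[R]_d := x + \row_i (if (i < k)%N then h 0 i else 0).
have pS (k : 'I_d) s : `|s| <= `|h 0 k| ->
    `|x - (s *: delta_mx 0 k + p k)| <= `|h|.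
  move=> sk; rewrite [leLHS]/Num.Def.normr/= mx_normrE bigmax_le// => -[i j] _ /=.
  rewrite !mxE ord1 eqxx /= [_ == k]eq_sym.
  have [<-|kj] := eqVneq k j.
    rewrite ltnn addr0 mulr1 opprD addrCA subrr addr0 normrN.
    by rewrite (le_trans sk)// normr_coord_le.
  rewrite mulr0 add0r opprD addrA subrr sub0r normrN.
  by case: ifP => _; rewrite ?normr0// normr_coord_le.
have step (k : 'I_d) : `|f (p k.+1) - f (p k) - h 0 k * 'D_(delta_mx 0 k) f x|
    <= e' * `|h|.
  have Bk s : `|s| <= `|h 0 k| -> D (s *: delta_mx 0 k + p k) /\ forall i : 'I_d,
     `|'D_(delta_mx 0 i) f x - 'D_(delta_mx 0 i) f (s *: delta_mx 0 k + p k)| <= e'.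
    by move=> sk; apply: Br; rewrite /= (le_lt_trans (pS _ _ sk)).
  have [|c ck] := @MVT_abs (fun s => f (s *: delta_mx 0 k + p k))
     (fun s => 'D_(delta_mx 0 k) f (s *: delta_mx 0 k + p k)) (h 0 k).
    by move=> s sk; apply: is_derive_line; apply: (df k).1; exact: (Bk _ sk).1.
  rewrite scale0r add0r.
  have -> : h 0 k *: delta_mx 0 k + p k = p k.+1.
    apply/rowP => i; rewrite !mxE eqxx /= ltnS.
    have [->|ik] := eqVneq i k; first by rewrite leqnn ltnn addr0 mulr1 addrC.
    by rewrite mulr0 add0r [in RHS]leq_eqVlt -val_eqE/= in ik *; rewrite (negbTE ik).
  move=> ->; rewrite mulrC -mulrBr normrM mulrC ler_pM//.
    by rewrite distrC; apply: (Bk _ ck).2.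
  exact: normr_coord_le.
have -> : h + x = p d.
  by apply/rowP => i; rewrite !mxE ltn_ord addrC.
have -> : f x = f (p 0).
  by congr f; apply/rowP => i; rewrite !mxE addr0.
rewrite -(telescope_sumr (fun k => f (p k)))// big_mkord /gradform -sumrB.
apply: (le_trans (ler_norm_sum _ _ _)).
apply: (@le_trans _ _ (\sum_(k < d) e' * `|h|)); first exact: ler_sum.
rewrite sumr_const card_ord -mulr_natl mulrA ler_wpM2r//.
by rewrite /e' mulrCA ler_piMr ?(ltW e0)// ler_pdivrMr// mul1r ler_nat.
Qed.

End C1_functions.

(** * Dominated series and termwise differentiation *)

Section dominated_series.
Context {R : realType}.
Implicit Types (u w : nat -> R).

Lemma cvg_sumr {K : numFieldType} {V : normedModType K} (I : Type) (r : seq I)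
    (f : I -> nat -> V) (l : I -> V) : (forall i, f i @ \oo --> l i) ->
  (fun n => \sum_(i <- r) f i n) @ \oo --> \sum_(i <- r) l i.
Proof.
move=> fl; elim: r => [|i r IH].
  rewrite big_nil (_ : (fun n => _) = cst 0); first exact: cvg_cst.
  by apply/funext => n; rewrite big_nil.
rewrite big_cons (_ : (fun n => _) = (fun n => f i n + \sum_(j <- r) f j n)).
  exact: cvgD.
by apply/funext => n; rewrite big_cons.
Qed.

Lemma cvgn_norm_le (v : nat -> R) l B N :
  v @ \oo --> l -> (forall n, (N <= n)%N -> `|v n| <= B) -> `|l| <= B.
Proof.
move=> vl vB; rewrite -(cvg_lim _ (cvg_norm vl))//.
apply: limr_le; first by apply/cvg_ex; eexists; exact: cvg_norm vl.
by exists N => // n /vB.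
Qed.

Lemma series_increment_le u w m n : (forall k, `|u k| <= w k) -> (m <= n)%N ->
  `|series u n - series u m| <= series w n - series w m.
Proof.
move=> uw mn; rewrite !sub_series_geq//.
by apply: (le_trans (ler_norm_sum _ _ _)); exact: ler_sum.
Qed.

Lemma dominated_series_cvg u w : (forall k, `|u k| <= w k) ->
  cvgn (series w) -> cvgn (series u).
Proof.
move=> uw cw; apply: normed_cvg; apply: series_le_cvg cw => // n /=; first exact: normr_ge0.
exact: (le_trans (normr_ge0 _) (uw n)).
Qed.

Lemma dominated_series_tail u w l W N : (forall k, `|u k| <= w k) ->
  series w @ \oo --> W -> series u @ \oo --> l ->
  `|l - series u N| <= W - series w N.
Proof.
move=> uw wW ul.
have w0 k : 0 <= w k by rewrite (le_trans _ (uw k)).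
apply: (@cvgn_norm_le (fun n => series u n - series u N) _ _ N).
  by apply: cvgB => //; exact: cvg_cst.
move=> n Nn; apply: (le_trans (series_increment_le uw Nn)).
rewrite lerB// -(cvg_lim _ wW)//; apply: nondecreasing_cvgn_le.
  exact: nondecreasing_series.
by apply/cvg_ex; exists W.
Qed.

Lemma dominated_series_norm_le u w l W : (forall k, `|u k| <= w k) ->
  series w @ \oo --> W -> series u @ \oo --> l -> `|l| <= W.
Proof.
move=> uw wW ul; have := dominated_series_tail 0 uw wW ul.
by rewrite /series /= !big_nil !subr0.
Qed.

End dominated_series.

Section pointed_lipschitz_norm.
Context {R : realType} {d : nat}.
Implicit Types (x h : 'rV[R]_d) (f g : 'rV[R]_d -> R) (s c : R).

Lemma near0_norm_lt (r : R) : 0 < r ->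
  \forall h \near (0 : 'rV[R]_d), `|h| < r.
Proof.
move=> r0; apply/nbhs_normP; exists r => //= h.
by rewrite /ball_/= sub0r normrN.
Qed.

(** The bound [c] on the norm `|f x| + s Lip_x(f)`, where [Lip_x(f)] is the
    best Lipschitz constant at [x] on the ball of radius [s].  Tying the weight
    of the Lipschitz constant to the radius makes this norm submultiplicative,
    so that geometric decay of powers only has to be observed at [x]. *)
Definition lipnorm_le x s c f := [/\ differentiable f x, `|f x| <= c &
  forall h, `|h| < s -> s * `|f (h + x) - f x| <= (c - `|f x|) * `|h|].

Lemma lipnorm_le_ge0 x s c f : lipnorm_le x s c f -> 0 <= c.
Proof. by case=> _ + _; exact: le_trans. Qed.

Lemma lipnorm_leW x s c c' f : c <= c' -> lipnorm_le x s c f ->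
  lipnorm_le x s c' f.
Proof.
move=> cc' [df fc fh]; split=> //; first exact: le_trans cc'.
by move=> h /fh /le_trans; apply; rewrite ler_wpM2r// lerB.
Qed.

Lemma lipnorm_le_cst x s a : lipnorm_le x s `|a| (cst a).
Proof.
split=> //= h _.
by rewrite /cst !subrr normr0 mulr0 mul0r.
Qed.

Lemma lipnorm_leD x s c1 c2 f g : 0 < s ->
  lipnorm_le x s c1 f -> lipnorm_le x s c2 g ->
  lipnorm_le x s (c1 + c2) (fun y => f y + g y).
Proof.
move=> s0 [df f1 fh] [dg g1 gh]; split.
- exact: differentiableD.
- by rewrite (le_trans (ler_normD _ _))// lerD.
move=> h hs; rewrite opprD addrACA.
apply: (@le_trans _ _ (s * (`|f (h + x) - f x| + `|g (h + x) - g x|))).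
  by rewrite ler_wpM2l ?(ltW s0)// ler_normD.
rewrite mulrDr (le_trans (lerD (fh h hs) (gh h hs)))// -mulrDl ler_wpM2r//.
by rewrite addrACA -opprD lerB// ler_normD.
Qed.

Lemma lipnorm_leM x s c1 c2 f g : 0 < s ->
  lipnorm_le x s c1 f -> lipnorm_le x s c2 g ->
  lipnorm_le x s (c1 * c2) (fun y => f y * g y).
Proof.
move=> s0 [df f1 fh] [dg g1 gh]; split.
- exact: differentiableM.
- by rewrite normrM ler_pM.
move=> h hs; have {}fh := fh h hs; have {}gh := gh h hs.
set Df := f (h + x) - f x in fh; set Dg := g (h + x) - g x in gh.
have -> : f (h + x) * g (h + x) - f x * g x = Df * g x + f x * Dg + Df * Dg.
  by rewrite /Df /Dg; ring.
rewrite normrM; set a := `|f x| in f1 fh *; set b := `|g x| in g1 gh *.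
have Dg1 : `|Dg| <= c2 - b.
  rewrite -(ler_pM2l s0) (le_trans gh)// mulrC ler_wpM2r ?subr_ge0//.
  exact: ltW.
apply: (@le_trans _ _ (s * (`|Df| * b + a * `|Dg| + `|Df| * `|Dg|))).
  rewrite ler_wpM2l ?(ltW s0)// (le_trans (ler_normD _ _))// normrM lerD//.
  by rewrite (le_trans (ler_normD _ _))// !normrM.
have a0 : 0 <= a by exact: normr_ge0.
have b0 : 0 <= b by exact: normr_ge0.
have := ler_wpM2r b0 fh; have := ler_wpM2l a0 gh.
have := ler_pM (mulr_ge0 (ltW s0) (normr_ge0 Df)) (normr_ge0 Dg) fh Dg1.
move: (`|Df|) (`|Dg|) (`|h|) => p q r; nra.
Qed.

Lemma lipnorm_leZ x s c a f : 0 < s -> lipnorm_le x s c f ->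
  lipnorm_le x s (`|a| * c) (fun y => a * f y).
Proof. by move=> s0; apply: lipnorm_leM => //; exact: lipnorm_le_cst. Qed.

Lemma lipnorm_le_sum x s (I : Type) (r : seq I) (c : I -> R)
    (f : I -> 'rV[R]_d -> R) : 0 < s ->
  (forall i, lipnorm_le x s (c i) (f i)) ->
  lipnorm_le x s (\sum_(i <- r) c i) (fun y => \sum_(i <- r) f i y).
Proof.
move=> s0 fc; elim: r => [|i r IH].
  have -> : (fun y => \sum_(i <- [::]) f i y) = cst 0.
    by apply/funext => y; rewrite big_nil.
  by have := lipnorm_le_cst x s 0; rewrite normr0 big_nil.
have -> : (fun y => \sum_(j <- i :: r) f j y) =
    (fun y => f i y + \sum_(j <- r) f j y).
  by apply/funext => y; rewrite big_cons.
by rewrite big_cons; exact: lipnorm_leD.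
Qed.

Lemma lipnorm_le_local x s c f g : 0 < s ->
  (forall h, `|h| < s -> f (h + x) = g (h + x)) ->
  lipnorm_le x s c f -> lipnorm_le x s c g.
Proof.
move=> s0 fg [df fc fh].
have fgx : f x = g x by rewrite -[x]add0r fg// normr0.
split; [|by rewrite -fgx|by move=> h hs; rewrite -fg// -fgx fh].
have gg : has_gradient g x (fun i => 'D_(delta_mx 0 i) f x).
  move=> e e0; have := differentiable_has_gradient df e0.
  by apply: filterS2 (near0_norm_lt s0) => h /fg <-; rewrite fgx.
exact: (@ex_diff _ _ _ _ _ _ _ (has_gradient_is_diff gg)).
Qed.

(** A function that is differentiable at [x] is Lipschitz at [x], and the
    weight [s] damps the Lipschitz constant. *)
Lemma differentiable_lipnorm x c f : differentiable f x -> `|f x| < c ->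
  \forall s \near 0^'+, lipnorm_le x s c f.
Proof.
move=> df fc.
have fg := differentiable_has_gradient df.
set g := (fun i => _) in fg.
have /nbhs_normP[r /= r0 Br] := fg 1 ltr01.
pose L := \sum_i `|g i| + 1.
have L0 : 0 < L by rewrite ltr_wpDl// sumr_ge0.
near=> s; split=> //; first exact: ltW.
move=> h hs.
have s0 : 0 < s by near: s; exact: nbhs_right_gt.
apply: (@le_trans _ _ (s * (L * `|h|))).
  rewrite ler_wpM2l ?(ltW s0)//.
  rewrite -[f (h + x) - f x](subrK (gradform g h)) (le_trans (ler_normD _ _))//.
  rewrite /L mulrDl addrC lerD ?gradform_norm_le//; apply: Br.
  by rewrite /ball_/= sub0r normrN (lt_le_trans hs)//; near: s; exact: nbhs_right_le.
rewrite mulrA ler_wpM2r// -ler_pdivlMr//; near: s; apply: nbhs_right_le.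
by rewrite divr_gt0// subr_gt0.
Unshelve. all: by end_near. Qed.

Lemma lipnorm_le_lipschitz x s c f h : 0 < s -> lipnorm_le x s c f ->
  `|h| < s -> `|f (h + x) - f x| <= c / s * `|h|.
Proof.
move=> s0 [_ _ fh] /fh {}fh.
rewrite -(ler_pM2l s0) (le_trans fh)// mulrA ler_wpM2r//.
by rewrite mulrCA divff ?gt_eqF// mulr1 lerBlDr lerDl.
Qed.

Lemma lipnorm_le_partial x s c f i : 0 < s -> lipnorm_le x s c f ->
  `|'D_(delta_mx 0 i) f x| <= c / s.
Proof.
move=> s0 fc; have c0 := lipnorm_le_ge0 fc; have [df _ _] := fc.
apply/ler_addgt0Pr => e e0.
have /nbhs_normP[r /= r0 Br] := differentiable_has_gradient df e0.
pose m := Num.min r s / 2.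
have m0 : 0 < m by rewrite divr_gt0// lt_min r0.
have mm : m < Num.min r s by rewrite ltr_pdivrMr// ltr_pMr ?lt_min ?r0// ltr1n.
have nd : `|m *: (delta_mx 0 i : 'rV[R]_d)| <= m.
  rewrite [leLHS]/Num.Def.normr/= mx_normrE bigmax_le ?(ltW m0)// => -[a b] _ /=.
  by rewrite !mxE; case: (_ && _); rewrite ?mulr1 ?mulr0 ?normr0 ?gtr0_norm// ltW.
move: mm; rewrite lt_min => /andP[mr ms].
have := Br (m *: delta_mx 0 i); rewrite /ball_/= sub0r normrN.
move=> /(_ (le_lt_trans nd mr)); rewrite linearZ/= gradform_delta.
have := lipnorm_le_lipschitz s0 fc (le_lt_trans nd ms).
set q := f _ - f x; set D := 'D_ _ _ _ => q1 q2.
rewrite -(ler_pM2l m0) -[leLHS](ger0_norm (mulr_ge0 _ _)) ?(ltW m0)//.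
rewrite normrM normr_id -normrM -[m * D](subKr q).
rewrite (le_trans (ler_normB _ _))// mulrDr lerD//.
  by rewrite (le_trans q1)// mulrC ler_wpM2r// divr_ge0// ltW.
by rewrite (le_trans q2)// mulrC ler_wpM2r// ltW.
Qed.

(** Termwise differentiation: the norms being summable, the gradients sum to
    the gradient of the sum. *)
Lemma lipnorm_le_series x s (w : nat -> R) W (f : nat -> 'rV[R]_d -> R) F :
  0 < s -> series w @ \oo --> W ->
  (forall k, lipnorm_le x s (w k) (f k)) ->
  (forall h, `|h| < s -> series (fun k => f k (h + x)) @ \oo --> F (h + x)) ->
  lipnorm_le x s W F /\
  forall i, series (fun k => 'D_(delta_mx 0 i) (f k) x) @ \oo -->
              'D_(delta_mx 0 i) F x.
Proof.
move=> s0 wW fw fF.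
have fx k : `|f k x| <= w k by case: (fw k).
have cw : cvgn (series w) by apply/cvg_ex; exists W.
have fFx : series (fun k => f k x) @ \oo --> F x.
  have := fF 0; rewrite normr0 => /(_ s0).
  by rewrite add0r.
have dfk k : differentiable (f k) x by case: (fw k).
have Df k := differentiable_has_gradient (dfk k).
have flip k h : `|h| < s -> `|f k (h + x) - f k x| <= w k / s * `|h|.
  exact: lipnorm_le_lipschitz.
have DFlip k i : `|'D_(delta_mx 0 i) (f k) x| <= w k / s.
  exact: lipnorm_le_partial.
pose G i := limn (series (fun k => 'D_(delta_mx 0 i) (f k) x)).
have wsW : series (fun k => w k / s) @ \oo --> W / s.
  rewrite [series _](_ : _ = (fun n => series w n / s)); last first.
    by apply/funext => n; rewrite /series /= mulr_suml.
  by apply: cvgMr_tmp.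
have DFG i : series (fun k => 'D_(delta_mx 0 i) (f k) x) @ \oo --> G i.
  by apply: (dominated_series_cvg (DFlip^~ i)); apply/cvg_ex; eexists; exact: wsW.
have FG : has_gradient F x G.
  move=> e e0.
  have e20 : 0 < e / 2 by rewrite divr_gt0.
  (* the increment of [f k] contributes [1 / s], and each of the [d] partial
     derivatives as much *)
  pose C := (1 + d%:R) / s.
  have C0 : 0 < C by rewrite divr_gt0// ltr_pwDl.
  pose rem k h := f k (h + x) - f k x -
    gradform (fun i => 'D_(delta_mx 0 i) (f k) x) h.
  have remw k h : `|h| < s -> `|rem k h| <= w k * (C * `|h|).
    move=> hs; rewrite /rem (le_trans (ler_normB _ _))//.
    rewrite /C mulrDl !mulrDl mulrDr lerD//.
      by rewrite mul1r mulrA flip.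
    rewrite (le_trans (gradform_norm_le _ _))// !mulrA ler_wpM2r//.
    apply: (@le_trans _ _ (\sum_(i < d) (w k / s))); first exact: ler_sum.
    by rewrite sumr_const card_ord -[leLHS]mulr_natr mulrAC.
  have remF h : `|h| < s ->
      series (rem^~ h) @ \oo --> F (h + x) - F x - gradform G h.
    move=> hs.
    have -> : series (rem^~ h) = (fun n => series (fun k => f k (h + x)) n -
        series (fun k => f k x) n - \sum_i h 0 i *
        series (fun k => 'D_(delta_mx 0 i) (f k) x) n).
      apply/funext => n; rewrite /series /rem /gradform /= !sumrB; congr (_ - _).
      by rewrite exchange_big /=; apply: eq_bigr => i _; rewrite mulr_sumr.
    apply: cvgB; first by apply: cvgB => //; exact: fF.
    apply: cvg_sumr => i; apply: cvgMl_tmp; exact: DFG.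
  have [N _ BN] : \forall n \near \oo, W - series w n <= e / 2 / C.
    have /cvgrPdist_le/(_ (e / 2 / C)) := wW.
    rewrite divr_gt0// => /(_ isT); apply: filterS => n.
    by apply: le_trans; rewrite ler_norm.
  have {}BN := BN N (leqnn N).
  have /filter_forall headN : forall k : 'I_N, \forall h \near (0 : 'rV[R]_d),
      `|rem k h| <= e / 2 / N.+1%:R * `|h|.
    by move=> k; apply: (Df k); rewrite divr_gt0.
  apply: filterS2 headN (near0_norm_lt s0) => h hN hs.
  have wCW : series (fun k => w k * (C * `|h|)) @ \oo --> W * (C * `|h|).
    rewrite [series _](_ : _ = (fun n => series w n * (C * `|h|))); last first.
      by apply/funext => n; rewrite /series /= mulr_suml.
    by apply: cvgMr_tmp.
  have tl := dominated_series_tail N (remw^~ h^~ hs) wCW (remF h hs).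
  rewrite -[X in `|X| <= _](subrK (series (rem^~ h) N)).
  rewrite (le_trans (ler_normD _ _))// [in leRHS](splitr e) mulrDl lerD//.
    rewrite (le_trans tl)// {1}/series /= -mulr_suml -mulrBl mulrA ler_wpM2r//.
    by rewrite -ler_pdivlMr.
  rewrite /series /= (le_trans (ler_norm_sum _ _ _))// big_mkord.
  apply: (@le_trans _ _ (\sum_(k < N) e / 2 / N.+1%:R * `|h|)).
    exact: ler_sum.
  rewrite sumr_const card_ord -[leLHS]mulr_natl mulrA ler_wpM2r//.
  rewrite mulrCA ler_piMr ?(ltW e20)// ler_pdivrMr// mul1r ler_nat//.
split; last by move=> i; rewrite (has_gradient_partial i FG).2.
split.
- exact: (@ex_diff _ _ _ _ _ _ _ (has_gradient_is_diff FG)).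
- exact: dominated_series_norm_le fx wW fFx.
move=> h hs.
have cfx : cvgn (series (fun k => `|f k x|)).
  by apply: dominated_series_cvg cw => k; rewrite normr_id.
(* subtracting the larger sum [\sum_k |f k x|] leaves a smaller bound than
   [W - |F x|], and one that is a termwise sum *)
have afx : `|F x| <= limn (series (fun k => `|f k x|)).
  exact: (dominated_series_norm_le (fun k => lexx _) cfx).
apply: (@le_trans _ _ ((W - limn (series (fun k => `|f k x|))) * `|h|)); last first.
  by rewrite ler_wpM2r// lerB.
rewrite -[X in X * _](gtr0_norm s0) -normrM.
apply: (@dominated_series_norm_le _ (fun k => s * (f k (h + x) - f k x))
  (fun k => (w k - `|f k x|) * `|h|)).
- by move=> k; rewrite normrM gtr0_norm//; case: (fw k) => _ _; exact.
- rewrite [series _](_ : _ = (fun n => (series w n -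
    series (fun k => `|f k x|) n) * `|h|)).
    by apply: cvgMr_tmp; apply: cvgB.
  by apply/funext => n; rewrite /series /= -mulr_suml sumrB.
- rewrite [series _](_ : _ = (fun n => s * (series (fun k => f k (h + x)) n -
    series (fun k => f k x) n))).
    by apply: cvgMl_tmp; apply: cvgB => //; exact: fF.
  by apply/funext => n; rewrite /series /= -mulr_sumr sumrB.
Qed.

End pointed_lipschitz_norm.

(** * Coefficients of rational functions expanded at infinity *)

Section power_series.
Context {R : realType}.
Implicit Types (c h : nat -> R) (p q : {poly R}).

(** If [k] were the first index with [c k != 0], dividing the sum by [w ^+ k]
    would give [c k] up to an error of order [w]. *)
Lemma power_series_eq0 c (r : R) : 0 < r ->
  (forall w, 0 < w < r -> series (fun i => c i * w ^+ i) @ \oo --> (0 : R)) ->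
  forall i, c i = 0.
Proof.
move=> r0 c0.
pose w0 := r / 2.
have w00 : 0 < w0 by rewrite divr_gt0.
have w0r : 0 < w0 < r by rewrite w00 ltr_pdivrMr// ltr_pMr// ltr1n.
have [K [K0 cK]] : exists K, 0 < K /\ forall i, `|c i| * w0 ^+ i <= K.
  have /cvg_series_cvg_0 cc : cvgn (series (fun i => c i * w0 ^+ i)).
    by apply/cvg_ex; eexists; exact: c0.
  have cc' : cvgn (fun i => c i * w0 ^+ i) by apply/cvg_ex; eexists; exact: cc.
  have /pinfty_ex_gt0[K K0 KP] := cvg_seq_bounded cc'.
  exists K; split=> // i; have : `|c i * w0 ^+ i| <= K by exact: KP.
  by rewrite normrM [`|w0 ^+ i|]ger0_norm ?exprn_ge0 ?(ltW w00)//.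
move=> i; elim/ltn_ind: i => k ck.
apply/eqP; rewrite -normr_eq0 eq_le normr_ge0 andbT; apply/ler_addgt0Pr => e e0.
(* the tail after the [k]-th term is at most [B * w * w ^+ k] for [w <= w0 / 2] *)
rewrite add0r; pose B := 2 * K / w0 ^+ k.+1.
have B0 : 0 < B by rewrite /B divr_gt0// ?mulr_gt0// exprn_gt0.
pose w := Num.min (w0 / 2) (e / B).
have w_gt0 : 0 < w by rewrite lt_min; apply/andP; split; apply: divr_gt0.
have ww0 : w <= w0 / 2 by rewrite ge_min lexx.
have wr : 0 < w < r.
  rewrite w_gt0 (le_lt_trans ww0)//= (lt_trans _ (andP w0r).2)//.
  by rewrite ltr_pdivrMr// ltr_pMr// ltr1n.
pose z := w / w0.
have z0 : 0 < z by rewrite divr_gt0.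
have z2 : z <= 2^-1 by rewrite ler_pdivrMr// mulrC.
have z1 : `|z| < 1.
  by rewrite gtr0_norm// (le_lt_trans z2)// invf_lt1// ltr1n.
have dom i : `|c i * w ^+ i| <= geometric K z i.
  rewrite /= normrM [`|w ^+ i|]ger0_norm ?exprn_ge0 ?(ltW w_gt0)//.
  rewrite /z expr_div_n mulrA ler_pdivlMr ?exprn_gt0//.
  by rewrite mulrAC ler_wpM2r// exprn_ge0// ltW.
have := dominated_series_tail k.+1 dom (cvg_geometric_series (a := K) z1) (c0 w wr).
rewrite geometric_seriesE ?lt_eqF ?(le_lt_trans (ler_norm z))//=.
rewrite /series /= big_nat_recr//= big_nat big1 => [|j /andP[_ jk]]; last first.
  by rewrite ck// mul0r.
rewrite !add0r normrN normrM [`|w ^+ k|]ger0_norm ?exprn_ge0 ?(ltW w_gt0)//.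
move=> H.
have z1' : 2^-1 <= 1 - z.
  by rewrite lerBrDl -lerBrDr (le_trans z2)// {2}(splitr 1) !div1r addrK.
have {H} : `|c k| * w ^+ k <= 2 * K * z ^+ k.+1.
  apply: (le_trans H); rewrite -mulrBl mulrBr mulr1 opprB addrC subrK.
  rewrite ler_pdivrMr ?(lt_le_trans _ z1')// ?invr_gt0//.
  rewrite mulrAC ler_wpM2r ?exprn_ge0 ?(ltW z0)// mulrAC -[leLHS]mul1r.
  by rewrite ler_wpM2r ?(ltW K0)// -ler_pdivrMl// mulr1.
rewrite /z expr_div_n mulrA mulrAC -/B exprS mulrA ler_pM2r ?exprn_gt0//.
move=> /le_trans; apply; rewrite mulrC -ler_pdivlMr// /w ge_min lexx.
by rewrite orbT.
Qed.

Lemma series_shift h (w L : R) m : series (fun i => h i * w ^+ i) @ \oo --> L ->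
  series (fun i => (if (m <= i)%N then h (i - m)%N else 0) * w ^+ i) @ \oo -->
  w ^+ m * L.
Proof.
move=> hL; rewrite -(cvg_shiftn m).
rewrite [X in X @ _ --> _](_ : _ = (fun n => w ^+ m *
    series (fun i => h i * w ^+ i) n)).
  by apply: cvgMl_tmp.
apply/funext => n; rewrite /series /=.
rewrite (big_cat_nat (leq0n m) (leq_addl n m)) /= big_nat big1 ?add0r; last first.
  by move=> i /andP[_ im]; rewrite leqNgt im mul0r.
rewrite -{1}[m]add0n big_addn addnK mulr_sumr; apply: eq_bigr => i _.
by rewrite leq_addl addnK exprD; ring.
Qed.

Lemma horner_rev p (w : R) N : w != 0 -> (size p <= N.+1)%N ->
  \sum_(j < N.+1) p`_(N - j) * w ^+ j = w ^+ N * p.[w^-1].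
Proof.
move=> w0 pN; rewrite (horner_coef_wide _ pN) mulr_sumr.
rewrite (reindex_inj rev_ord_inj) /=; apply: eq_bigr => j _.
have jN : (j <= N)%N by rewrite -ltnS.
rewrite subSS subKn// exprVn mulrCA; congr (_ * _).
by rewrite expfB_cond// (negbTE w0).
Qed.

(** Multiplying [q(z) (\sum_i h i z^{-i}) = p(z)] by [z^{-N}] gives an identity
    of power series in [z^{-1}]; its coefficients are compared. *)
Lemma rational_expansion_coef h p q N : q != 0 ->
  (size p <= N.+1)%N -> (size q <= N.+1)%N ->
  (exists r : R, forall t, r < t ->
    series (fun i => h i * t ^- i) @ \oo --> p.[t] / q.[t]) ->
  forall i, \sum_(j < N.+1) q`_(N - j) * (if (j <= i)%N then h (i - j)%N else 0) =
            if (i <= N)%N then p`_(N - i) else 0.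
Proof.
move=> q0 pN qN [r hr] i; apply/eqP; rewrite -subr_eq0; apply/eqP; move: i.
(* beyond [b] the expansion converges and [q] has no root *)
pose b := `|r| + `|polyrcf.cauchy_bound q| + 1.
have b0 : 0 < b by rewrite ltr_wpDl// addr_ge0.
apply: (@power_series_eq0 _ b^-1); first by rewrite invr_gt0.
move=> w /andP[w0 wb].
have w_neq0 : w != 0 by rewrite gt_eqF.
have bw : b < w^-1 by rewrite -[b]invrK ltf_pV2// posrE invr_gt0.
have rw : r < w^-1.
  rewrite (le_lt_trans _ bw)// (le_trans (ler_norm r))// /b -addrA lerDl.
  by rewrite addr_ge0.
have qw : q.[w^-1] != 0.
  apply/eqP => /(polyrcf.cauchy_boundP q0); apply/negP; rewrite -leNgt.
  rewrite (@ger0_norm _ w^-1) ?invr_ge0 ?(ltW w0)// (le_trans _ (ltW bw))//.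
  by rewrite (le_trans (ler_norm _))// /b addrAC lerDr addr_ge0.
have hw : series (fun i => h i * w ^+ i) @ \oo --> p.[w^-1] / q.[w^-1].
  have := hr _ rw; rewrite [X in series X](_ : _ = (fun i => h i * w ^+ i))//.
  by apply/funext => i; rewrite exprVn invrK.
rewrite [X in series X](_ : _ = (fun i =>
  \sum_(j < N.+1) q`_(N - j) * ((if (j <= i)%N then h (i - j)%N else 0) * w ^+ i) -
  (if (i <= N)%N then p`_(N - i) else 0) * w ^+ i)); last first.
  apply/funext => i; rewrite mulrBl mulr_suml; congr (_ - _).
  by apply: eq_bigr => j _; rewrite mulrA.
rewrite [series _](_ : _ = (fun n => \sum_(j < N.+1) q`_(N - j) *
    series (fun i => (if (j <= i)%N then h (i - j)%N else 0) * w ^+ i) n -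
  series (fun i => (if (i <= N)%N then p`_(N - i) else 0) * w ^+ i) n)); last first.
  apply/funext => n; rewrite /series /= sumrB; congr (_ - _).
  by rewrite exchange_big /=; apply: eq_bigr => j _; rewrite mulr_sumr.
have E0 : \sum_(j < N.+1) q`_(N - j) * (w ^+ j * (p.[w^-1] / q.[w^-1])) -
    w ^+ N * p.[w^-1] = 0.
  under eq_bigr do rewrite mulrA.
  by rewrite -mulr_suml horner_rev// -mulrA (mulrCA q.[_]) divff// mulr1 subrr.
rewrite -[X in _ --> X]E0; apply: cvgB.
  by apply: cvg_sumr => j; apply: cvgMl_tmp; exact: series_shift.
rewrite -horner_rev//; apply/cvg_ballP => e e0.
exists N.+1 => // n /= Nn; rewrite /series /=.
rewrite (big_cat_nat (leq0n N.+1) Nn) /= [X in _ + X]big_nat [X in _ + X]big1.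
  rewrite addr0 big_mkord [X in ball _ _ X](_ : _ = \sum_(j < N.+1) p`_(N - j) * w ^+ j).
    exact: ballxx.
  by apply: eq_bigr => j _; rewrite -ltnS ltn_ord.
by move=> j /andP[Nj _]; rewrite leqNgt Nj mul0r.
Qed.

End power_series.

(** * Complex sequences and stable linear recurrences *)

Section complex_sequences.
Context {R : realType}.
Implicit Types (u : nat -> R[i]) (z : R[i]).
Local Notation normc := (@ComplexField.Normc.normc R).

Lemma normcE_C z : `|z| = (normc z)%:C.
Proof. by rewrite normc_def; case: z. Qed.

Lemma normc_le_ReIm z : normc z <= `|complex.Re z| + `|complex.Im z|.
Proof.
case: z => a b /=.
rewrite -[leRHS]ger0_norm ?addr_ge0// -sqrtr_sqr ler_wsqrtr//.
by rewrite sqrrD !real_normK ?num_real// lerD2r lerDl mulrn_wge0// mulr_ge0.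
Qed.

Lemma Re_le_normc z : `|complex.Re z| <= normc z.
Proof. by rewrite -lecR -normcE_C normc_ge_Re. Qed.

Lemma Im_le_normc z : `|complex.Im z| <= normc z.
Proof.
case: z => a b /=; rewrite -sqrtr_sqr ler_wsqrtr// lerDr.
exact: sqr_ge0.
Qed.

Lemma ReB (x y : R[i]) : complex.Re (x - y) = complex.Re x - complex.Re y.
Proof. by case: x y => [a b] [c e]. Qed.

Lemma ImB (x y : R[i]) : complex.Im (x - y) = complex.Im x - complex.Im y.
Proof. by case: x y => [a b] [c e]. Qed.

Lemma gt0_complexE (e : R[i]) : 0 < e -> e = (complex.Re e)%:C /\ 0 < complex.Re e.
Proof.
by case: e => a b; rewrite ltcE /= => /andP[/eqP-> a0].
Qed.

(** Convergence for the norm of [R[i]], whose values are themselves complex,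
    is convergence of the real and imaginary parts. *)
Lemma cvg_complexP u z : (u : nat -> R[i]^o) @ \oo --> (z : R[i]^o) <->
  (fun n => complex.Re (u n)) @ \oo --> complex.Re z /\
  (fun n => complex.Im (u n)) @ \oo --> complex.Im z.
Proof.
split.
- move/cvgrPdist_le => uz; split; apply/cvgrPdist_le => e e0.
  + have /uz : 0 < e%:C by rewrite ltcR.
    apply: filterS => n; rewrite normcE_C lecR; apply: le_trans.
    by rewrite -ReB Re_le_normc.
  + have /uz : 0 < e%:C by rewrite ltcR.
    apply: filterS => n; rewrite normcE_C lecR; apply: le_trans.
    by rewrite -ImB Im_le_normc.
- move=> [/cvgrPdist_le ur /cvgrPdist_le ui]; apply/cvgrPdist_le => e.
  move=> /gt0_complexE[-> e0].
  have e20 : 0 < complex.Re e / 2 by rewrite divr_gt0.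
  apply: filterS2 (ur _ e20) (ui _ e20) => n rn iN.
  rewrite normcE_C lecR (le_trans (normc_le_ReIm _))// (splitr (complex.Re e)).
  by rewrite ReB ImB lerD.
Qed.

End complex_sequences.

Section linear_recurrences.
Context {R : realType}.
Local Notation normc := (@ComplexField.Normc.normc R).

Lemma contraction_cvg0 (x b : nat -> R) (a : R) : 0 <= a < 1 ->
  (forall n, 0 <= x n) -> (forall n, x n.+1 <= a * x n + b n) ->
  b @ \oo --> (0 : R) -> x @ \oo --> (0 : R).
Proof.
move=> /andP[a0 a1] x0 xS b0; apply/cvgrPdist_le => e e0.
have a1' : 0 < 1 - a by rewrite subr_gt0.
pose m := e / 2 * (1 - a).
have m0 : 0 < m by rewrite mulr_gt0// divr_gt0.
have [N _ bN] : \forall n \near \oo, b n <= m.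
  move/cvgrPdist_le : b0 => /(_ _ m0); apply: filterS => n.
  by rewrite sub0r normrN; apply: le_trans; exact: ler_norm.
have xN n : x (N + n)%N <= e / 2 + a ^+ n * x N.
  elim: n => [|n IH].
    by rewrite addn0 expr0 mul1r lerDr divr_ge0// ltW.
  rewrite addnS (le_trans (xS _))//.
  have := bN (N + n)%N (leq_addr _ _); have := ler_wpM2l a0 IH.
  rewrite /m exprS -[a * _ * _]mulrA; move: (a ^+ n * x N) (x (N + n)%N) (b (N + n)%N).
  by move=> p q r; nra.
have : geometric (x N) a @ \oo --> 0 by apply: cvg_geometric; rewrite ger0_norm.
move/cvgrPdist_le => /(_ (e / 2)); rewrite divr_gt0// => /(_ isT)[M _ aM].
exists (N + M)%N => // n /= NMn.
rewrite sub0r normrN ger0_norm// -(subnKC (leq_trans (leq_addr M N) NMn)).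
rewrite (le_trans (xN _))// [leRHS]splitr lerD2l.
have /aM : (M <= n - N)%N by rewrite leq_subRL ?(leq_trans (leq_addr M N) NMn).
by rewrite /= sub0r normrN mulrC; apply: le_trans; exact: ler_norm.
Qed.

(** The shift operator acts on sequences and makes them a module over
    polynomials: [shift_act p u] is [p(S) u]. *)
Definition shift_act (p : {poly R[i]}) (u : nat -> R[i]) (e : nat) : R[i] :=
  \sum_(k < size p) p`_k * u (e + k)%N.

Lemma shift_act_wide (p : {poly R[i]}) u e n : (size p <= n)%N ->
  shift_act p u e = \sum_(k < n) p`_k * u (e + k)%N.
Proof.
move=> pn; rewrite /shift_act (big_ord_widen _ (fun k => p`_k * u (e + k)%N) pn).
rewrite big_mkcond; apply: eq_bigr => k _; case: ltnP => // pk.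
by rewrite nth_default// mul0r.
Qed.

Lemma shift_act_XsubC a (p : {poly R[i]}) u e :
  shift_act (('X - a%:P) * p) u e = shift_act p u e.+1 - a * shift_act p u e.
Proof.
have s1 : (size (('X - a%:P) * p)%R <= (size p).+1)%N.
  by rewrite (leq_trans (size_polyMleq _ _))// size_XsubC.
rewrite (shift_act_wide _ _ s1) mulrBl.
under eq_bigr do rewrite coefB coefXM coefCM mulrBl.
rewrite sumrB big_ord_recl /= mul0r add0r; congr (_ - _).
  by apply: eq_bigr => k _; rewrite /bump /= add1n addnS addSn.
rewrite (@shift_act_wide _ _ _ (size p).+1)// mulr_sumr.
by apply: eq_bigr => k _; rewrite mulrA.
Qed.

(** Each factor [S - a] with [|a| < 1] can be inverted on null sequences:
    a sequence with [u (n+1) - a u n] null is itself null. *)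
Lemma shift_act_null (s : seq R[i]) u : all (fun a => `|a| < 1) s ->
  (fun n => normc (shift_act (\prod_(a <- s) ('X - a%:P)) u n)) @ \oo --> (0 : R) ->
  (fun n => normc (u n)) @ \oo --> (0 : R).
Proof.
elim: s => [_|a s IH /= /andP[a1 s1]].
  rewrite big_nil; rewrite [X in X @ _ --> _](_ : _ = (fun n => normc (u n)))//.
  apply/funext => n; rewrite /shift_act size_poly1 big_ord_recl big_ord0.
  by rewrite coef1 mul1r addr0 addn0.
rewrite big_cons => H; apply: IH => //; move: H.
under eq_fun do rewrite shift_act_XsubC.
set v := shift_act _ u; move=> H.
apply: (contraction_cvg0 (a := normc a) _ _ _ H).
- by rewrite -!lecR -ltcR -normcE_C a1 normr_ge0.
- by move=> n; rewrite -lecR -normcE_C normr_ge0.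
- move=> n; rewrite -ComplexField.Normc.normcM addrC -{1}[v n.+1](subrK (a * v n)).
  exact: le_normcD.
Qed.

Lemma stable_recurrence_cvg0 (q : {poly R}) (h : nat -> R) N :
  q != 0 -> (forall z : R[i], root (map_poly (real_complex R) q) z -> `|z| < 1) ->
  (forall e, (N <= e)%N -> \sum_(k < size q) q`_k * h (e + k)%N = 0) ->
  h @ \oo --> (0 : R).
Proof.
move=> q0 qroot hq.
pose Q := map_poly (real_complex R) q.
pose u n := (h (n + N)%N)%:C.
have [s sE] := closed_field_poly_normal Q.
have Q0 : lead_coef Q != 0 by rewrite lead_coef_eq0 map_poly_eq0.
have s1 : all (fun a => `|a| < 1) s.
  apply/allP => a sa; apply: qroot; rewrite -/Q sE rootZ//.
  by rewrite root_prod_XsubC.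
have : (fun n => normc (u n)) @ \oo --> (0 : R).
  apply: (shift_act_null s1).
  rewrite [X in X @ _ --> _](_ : _ = cst 0); first exact: cvg_cst.
  apply/funext => n /=; rewrite -[RHS](@ComplexField.Normc.normc0 R); congr normc.
  apply: (mulfI Q0); rewrite mulr0.
  have /hq : (N <= n + N)%N by rewrite leq_addl.
  move=> /(congr1 (real_complex R)); rewrite rmorph0 rmorph_sum => <-.
  rewrite /shift_act mulr_sumr.
  have -> : size (\prod_(a <- s) ('X - a%:P)) = size q.
    by rewrite -(size_map_poly (real_complex R) q) -/Q sE size_scale.
  apply: eq_bigr => k _; rewrite mulrA -coefZ -sE coef_map rmorphM /u.
  by rewrite addnAC.
move=> /cvgrPdist_le u0; apply/cvgrPdist_le => e /u0.
move=> [M _ MP]; exists (M + N)%N => // n /= MNn.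
have Nn : (N <= n)%N by rewrite (leq_trans _ MNn)// leq_addl.
have /MP : (M <= n - N)%N by rewrite leq_subRL// addnC.
rewrite /= /u subnK// !sub0r !normrN; apply: le_trans.
by rewrite (le_trans (Re_le_normc (h n)%:C))// ler_norm.
Qed.

End linear_recurrences.

(** * Markov parameters of a smooth family *)

Section markov_parameters.
Context {R : realType} {m : nat}.
Implicit Types (H : nat -> 'M[R]_m) (num den : 'M[{poly R}]_m).

Lemma zseries_real (u : nat -> R) (t : R) n :
  zseries u t%:C n = (series (fun i => u i * t ^- i) n)%:C.
Proof.
rewrite /zseries /series /= rmorph_sum; apply: eq_bigr => i _.
by rewrite rmorphM/= fmorphV rmorphXn.
Qed.

Lemma has_transfer_real H num den a b : has_transfer H num den ->
  exists r : R, forall t, r < t ->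
    series (fun i => H i a b * t ^- i) @ \oo -->
    (num a b).[t] / (den a b).[t].
Proof.
move=> /(_ a b)[_ [r hr]]; exists `|r| => t rt.
have t0 : 0 <= t by rewrite (le_trans _ (ltW rt)).
have := hr t%:C; rewrite ger0_norm ?lecR// ltcR (le_lt_trans (ler_norm r) rt).
have -> : (map_poly (real_complex R) (num a b)).[t%:C] /
    (map_poly (real_complex R) (den a b)).[t%:C] =
    ((num a b).[t] / (den a b).[t])%:C.
  by rewrite rmorphM/= fmorphV/= !horner_map.
move=> /(_ isT)/cvg_complexP[+ _] /=.
by under eq_fun do rewrite zseries_real.
Qed.

(** Dividing numerator and denominator by their greatest common divisor does
    not change the expansion, and makes the roots of the denominator poles; the
    entry then satisfies a recurrence all of whose characteristic roots lie in
    the open unit disc. *)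
Lemma stable_markov_param_cvg0 (s : linear_system R m) a b :
  (exists num den, has_transfer (markov_param s) num den) -> stable s ->
  (fun i => markov_param s i a b) @ \oo --> (0 : R).
Proof.
move=> [num [den tr]] st.
have [q0 _] := tr a b.
have [r hr] := has_transfer_real a b tr.
set p := num a b in q0 hr; set q := den a b in q0 hr.
pose g := gcdp p q; pose p' := p %/ g; pose q' := q %/ g.
have qE : q = q' * g by rewrite divpK// dvdp_gcdr.
have pE : p = p' * g by rewrite divpK// dvdp_gcdl.
have q'0 : q' != 0 by apply: contraNneq q0 => q'0; rewrite qE q'0 mul0r.
have qroot z : root (map_poly (real_complex R) q') z -> `|z| < 1.
  by move=> zr; apply: st; exists num, den; split=> //; exists a, b.
pose N := (size p' + size q')%N.
have pN : (size p' <= N.+1)%N by rewrite leqW// leq_addr.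
have qN : (size q' <= N.+1)%N by rewrite leqW// leq_addl.
have hr' : exists r : R, forall t, r < t ->
    series (fun i => markov_param s i a b * t ^- i) @ \oo --> p'.[t] / q'.[t].
  exists (Num.max r (polyrcf.cauchy_bound q)) => t; rewrite gt_max => /andP[rt ct].
  have qt : q.[t] != 0.
    apply/eqP => /(polyrcf.cauchy_boundP q0); apply/negP; rewrite -leNgt.
    by rewrite (le_trans (ltW ct))// ler_norm.
  have gt0 : g.[t] != 0.
    by apply: contraNneq qt => gt0; rewrite qE hornerM gt0 mulr0.
  have -> : p'.[t] / q'.[t] = p.[t] / q.[t].
    by rewrite pE qE !hornerM -mulf_div divff// mulr1.
  exact: hr.
apply: (stable_recurrence_cvg0 (N := 1) q'0 qroot) => e e1.
have eN : (e + N <= N)%N = false by rewrite leqNgt -{1}[N]add0n ltn_add2r e1.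
have := rational_expansion_coef q'0 pN qN hr' (e + N)%N; rewrite eN => E0; rewrite -[RHS]E0.
rewrite [RHS](reindex_inj rev_ord_inj) /=.
rewrite (big_ord_widen _ (fun k => q'`_k * markov_param s (e + k)%N a b) qN).
rewrite big_mkcond; apply: eq_bigr => k _.
have kN : (k <= N)%N by rewrite -ltnS.
rewrite subSS subKn// (leq_trans (leq_subr _ _)) ?leq_addl//.
rewrite -addnBA ?leq_subr// subKn//.
by case: ltnP => // qk; rewrite nth_default// mul0r.
Qed.

(** Among monic polynomials of bounded degree with continuous coefficients the
    degree is locally constant: the leading coefficient cannot approach a
    coefficient that vanishes, nor leave a coefficient equal to one. *)
Lemma monic_size_near {T : topologicalType} (x : T) (q : T -> {poly R}) N :
  (\forall y \near x, q y \is monic /\ (size (q y) <= N)%N) ->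
  (forall k, {for x, continuous (fun y => (q y)`_k)}) ->
  \forall y \near x, size (q y) = size (q x).
Proof.
move=> qN qc; have [qx _] := nbhs_singleton qN.
have h2 : 0 < 2^-1 :> R by rewrite invr_gt0.
have /filter_forall near_c : forall k : 'I_N, \forall y \near x,
    `|(q x)`_k - (q y)`_k| <= 2^-1.
  by move=> k; have /cvgrPdist_le := qc k; apply.
have near_l : \forall y \near x, `|1 - (q y)`_(size (q x)).-1| <= 2^-1.
  have /cvgrPdist_le /(_ _ h2) := qc (size (q x)).-1.
  by rewrite -lead_coefE (monicP qx).
apply: filterS3 qN near_c near_l => y [qy szy] cy ly.
have s0 z : q z \is monic -> (0 < size (q z))%N.
  by move=> /monic_neq0; rewrite size_poly_gt0.
have half (a : R) : `|a - 1| <= 2^-1 -> a != 0.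
  by apply: contraTneq => ->; rewrite sub0r normrN normr1 -ltNge invf_lt1// ltr1n.
apply/eqP; rewrite eqn_leq; apply/andP; split.
  rewrite leqNgt; apply/negP => xy.
  have kN : ((size (q y)).-1 < N)%N by rewrite prednK ?s0.
  have := cy (Ordinal kN); rewrite /= -lead_coefE (monicP qy).
  rewrite nth_default; last by rewrite -ltnS prednK ?s0.
  by move=> /half; rewrite eqxx.
rewrite -(prednK (s0 _ qx)); apply: contraTT isT; rewrite -ltnNge.
rewrite ltnS => yx; rewrite distrC in ly; have := half _ ly.
by rewrite nth_default ?eqxx.
Qed.

End markov_parameters.

Lemma near_eq_differentiable {R : realType} {d : nat} (f g : 'rV[R]_d -> R) x :
  (\forall y \near x, f y = g y) -> differentiable f x -> differentiable g x.
Proof.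
move=> fg df; have fgx := nbhs_singleton fg.
have gg : has_gradient g x (fun i => 'D_(delta_mx 0 i) f x).
  move=> e e0; case/nbhs_normP: fg => r /= r0 Br.
  apply: filterS2 (differentiable_has_gradient df e0) (near0_norm_lt r0) => h + hr.
  by rewrite -fgx -Br//= /ball_/= opprD addrCA subrr addr0 normrN.
exact: (@ex_diff _ _ _ _ _ _ _ (has_gradient_is_diff gg)).
Qed.

Section smooth_markov_parameters.
Context {R : realType} {m d : nat}.
Variables (D : set 'rV[R]_d) (s : 'rV[R]_d -> linear_system R m).

(** The expansion coefficients are obtained from the coefficients of numerator
    and denominator by a recurrence that only divides by the leading
    coefficient. *)
Lemma markov_param_differentiable x l a b : open D -> D x -> smooth_family D s ->
  differentiable (fun y => markov_param (s y) l a b) x.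
Proof.
move=> oD Dx [[N [num [den [tr cf]]]] _].
have nD : \forall y \near x, D y by exact: open_nbhs_nbhs.
have dnum k : differentiable (fun y => (num y a b)`_k) x.
  exact: class_C1_differentiable oD ((cf a b k).1 1%N) Dx.
have dden k : differentiable (fun y => (den y a b)`_k) x.
  exact: class_C1_differentiable oD ((cf a b k).2 1%N) Dx.
have szden : \forall y \near x, size (den y a b) = size (den x a b).
  apply: (monic_size_near (N := N)).
    by apply: filterS nD => y Dy; have [_ /(_ a b)[]] := tr y Dy.
  by move=> k; apply: differentiable_continuous; exact: dden.
have [_ /(_ a b)[qm _ qN]] := tr x Dx.
have q0 := monic_neq0 qm.
pose e := (size (den x a b)).-1.
have eS : e.+1 = size (den x a b) by rewrite /e prednK// size_poly_gt0.
have eN : (e <= N)%N by rewrite (leq_trans _ qN)// -eS.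
elim/ltn_ind: l => l IH.
(* at index [N - e + l], where [e] is the degree of the denominator, the term of
   highest degree is its leading coefficient times the [l]-th Markov parameter *)
pose i := (N - e + l)%N.
have iN : (N - e <= i)%N by rewrite leq_addr.
have coefE y : D y -> \sum_(j < N.+1) (den y a b)`_(N - j) *
     (if (j <= i)%N then markov_param (s y) (i - j)%N a b else 0) =
     (if (i <= N)%N then (num y a b)`_(N - i) else 0).
  move=> Dy; have [try /(_ a b)[ym pN qN']] := tr y Dy.
  apply: (rational_expansion_coef (p := num y a b)
    (h := fun i => markov_param (s y) i a b)); rewrite ?monic_neq0// ?(leqW pN) ?(leqW qN')//.
  exact: has_transfer_real try.
pose F y := (if (i <= N)%N then (num y a b)`_(N - i) else 0) -
  \sum_(j < N.+1) (if (N - e < j <= i)%N then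
     (den y a b)`_(N - j) * markov_param (s y) (i - j)%N a b else 0).
have dF : differentiable F x.
  apply: differentiableB.
    by case: (i <= N)%N; [exact: dnum|exact: differentiable_cst].
  rewrite (_ : (fun y => \sum_(j < _) _) = \sum_(j < N.+1) (fun y =>
    if (N - e < j <= i)%N then
     (den y a b)`_(N - j) * markov_param (s y) (i - j)%N a b else 0)); last first.
    by apply/funext => y; rewrite fct_sumE.
  apply: differentiable_sum => j.
  have [/andP[j1 j2]|_] := boolP (N - e < j <= i)%N.
    apply: differentiableM; first exact: dden.
    apply: IH; rewrite /i -(ltn_add2r j) subnK// addnC ltn_add2l//.
  exact: differentiable_cst.
have FE : \forall y \near x, F y = markov_param (s y) l a b.
  apply: filterS2 nD szden => y Dy szy.
  rewrite /F -coefE// -sumrB.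
  have jlt : (N - e < N.+1)%N by rewrite ltnS leq_subr.
  rewrite (bigD1 (Ordinal jlt)) //= ltnn /= subr0 iN subKn// addKn.
  have [_ /(_ a b)[/monicP ym _ _]] := tr y Dy.
  rewrite {1}/e -szy -lead_coefE ym mul1r big1 ?addr0// => j /negP jNe.
  have {}jNe : (j : nat) != (N - e)%N by apply/eqP => je; apply: jNe; apply/eqP/val_inj.
  case: ltnP => [j1|j1] /=.
    by case: ifP => _; rewrite ?mulr0 ?subrr.
  rewrite nth_default ?mul0r ?subr0// szy -eS.
  have jN : (j <= N)%N by rewrite -ltnS.
  by rewrite ltn_subRL addnC -ltn_subRL ltn_neqAle jNe.
exact: near_eq_differentiable FE dF.
Qed.


End smooth_markov_parameters.

(** * Realization from the Hankel matrix *)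

Section hankel_realization.
Context {K : fieldType} {m : nat}.
Implicit Types (h : nat -> 'M[K]_m) (p q : nat * 'I_m).

(** Indexing the infinite block Hankel matrix by a block number and a position
    inside the block frees its minors from the sizes of the truncations, and
    turns the shift by one block into an operation on indices. *)
Definition hankel_entry h p q : K := h (p.1 + q.1).+1 p.2 q.2.

Definition shift_index k p : nat * 'I_m := (p.1 + k, p.2)%N.

Lemma hankel_entry_shift h k p q : hankel_entry h (shift_index k p) q = hankel_entry h p (shift_index k q).
Proof. by rewrite /hankel_entry /= addnAC addnA. Qed.

Definition hankel_minor h n1 n2 (f : 'I_n1 -> nat * 'I_m)
    (g : 'I_n2 -> nat * 'I_m) :=
  \matrix_(i, j) hankel_entry h (f i) (g j).

End hankel_realization.

Section hankel_rank.
Context {R : realType} {m : nat}.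
Implicit Types (h : nat -> 'M[R]_m) (p q : nat * 'I_m).
Local Notation block_sum k := (\sum_(i < k) m)%N.

Lemma hankel_minor_rank h n1 n2 (f : 'I_n1 -> nat * 'I_m)
    (g : 'I_n2 -> nat * 'I_m) n :
  (forall k, (\rank (hankel h k) <= n)%N) -> (\rank (hankel_minor h f g) <= n)%N.
Proof.
move=> rn.
pose k := (\max_i (f i).1 + \max_i (g i).1).+1.
have idx p : (p.1 < k)%N -> exists i : 'I_(block_sum k),
    (tagnat.sig1 i : nat, tagnat.sig2 i) = p.
  case: p => p a /= pk; exists (@tagnat.Rank _ (fun=> m) (Ordinal pk) a).
  rewrite tagnat.Rank1K/=; congr pair; apply: val_inj => /=.
  by rewrite tagnat.Rank2K.
have fk i : ((f i).1 < k)%N.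
  rewrite ltnS; apply: leq_trans (leq_addr _ _).
  exact: (leq_bigmax (F := fun i => (f i).1)).
have gk i : ((g i).1 < k)%N.
  rewrite ltnS; apply: leq_trans (leq_addl _ _).
  exact: (leq_bigmax (F := fun i => (g i).1)).
have /choice[f' f'P] i := idx _ (fk i).
have /choice[g' g'P] i := idx _ (gk i).
have -> : hankel_minor h f g = rowsub f' (colsub g' (hankel h k)).
  by apply/matrixP => i j; rewrite !mxE -f'P -g'P.
rewrite (leq_trans _ (rn k))// (leq_trans (mxrankS (rowsub_sub _ _)))//.
rewrite -mxrank_tr -[leqRHS]mxrank_tr mxrankS//.
rewrite (_ : (colsub _ _)^T = rowsub g' (hankel h k)^T) ?rowsub_sub//.
by apply/matrixP => i j; rewrite !mxE.
Qed.

Lemma hankel_minor_unit h k : exists f g : 'I_(\rank (hankel h k)) -> nat * 'I_m,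
  hankel_minor h f g \in unitmx.
Proof.
set A := hankel h k.
pose f1 := maxrankfun A.
have Bfull : row_full (rowsub f1 A)^T.
  by rewrite /row_full mxrank_tr; exact: maxrowsub_free.
pose g1 := fullrankfun Bfull.
exists (fun i => (tagnat.sig1 (f1 i) : nat, tagnat.sig2 (f1 i))).
exists (fun i => (tagnat.sig1 (g1 i) : nat, tagnat.sig2 (g1 i))).
have := fullrowsub_unit Bfull; rewrite -unitmx_tr => U.
rewrite [X in X \in _](_ : _ = (rowsub g1 (rowsub f1 A)^T)^T)//.
by apply/matrixP => i j; rewrite !mxE.
Qed.

Section realization.
Variables (h : nat -> 'M[R]_m) (n : nat) (f g : 'I_n -> nat * 'I_m).
Hypothesis rank_le : forall k, (\rank (hankel h k) <= n)%N.
Let M := hankel_minor h f g.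
Hypothesis M_unit : M \in unitmx.
Let rowp p := \row_j hankel_entry h p (g j).
Let colp q := \col_i hankel_entry h (f i) q.

(** A Hankel matrix of rank [n] is determined by the row and column of an
    invertible [n x n] minor: the bordered minor is singular, and its
    determinant is that of [M] times the difference of the two sides. *)
Lemma hankel_entry_factor p q : hankel_entry h p q = (rowp p *m invmx M *m colp q) 0 0.
Proof.
pose B : 'M[R]_(n + 1) := block_mx M (colp q) (rowp p) (hankel_entry h p q)%:M.
have B0 : \det B = 0.
  apply/eqP/negPn/negP => B0.
  have : B \in unitmx by rewrite unitmxE unitfE.
  move=> /mxrank_unit BE.
  (* [B] is the minor on the rows [f, p] and the columns [g, q] *)
  pose f' (i : 'I_(n + 1)) := match fintype.split i with inl a => f a | inr _ => p end.
  pose g' (i : 'I_(n + 1)) := match fintype.split i with inl a => g a | inr _ => q end.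
  have := hankel_minor_rank f' g' rank_le.
  suff -> : hankel_minor h f' g' = B by rewrite BE addn1 ltnn.
  apply/matrixP => i j; rewrite !mxE /f' /g'.
  case: (fintype.split i) => a; rewrite !mxE; case: (fintype.split j) => b; rewrite !mxE//.
  by rewrite !ord1 mulr1n.
pose L : 'M[R]_(n + 1) := block_mx 1%:M 0 (- (rowp p *m invmx M)) 1%:M.
have : \det (L *m B) = 0 by rewrite det_mulmx B0 mulr0.
rewrite mulmx_block !mul1mx !mul0mx !addr0 mulNmx mulmxKV// addNr.
rewrite det_ublock => /eqP; rewrite mulf_eq0 -[\det M == 0]negbK -unitfE -unitmxE.
rewrite M_unit /= mulNmx det_mx11 addrC !mxE eqxx mulr1n subr_eq0.
by move=> /eqP ->.
Qed.

Let A := invmx M *m hankel_minor h (shift_index 1 \o f) g.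

Lemma hankel_row_shift p k : rowp (shift_index k p) = rowp p *m A ^+ k.
Proof.
elim: k p => [|k IH] p.
  rewrite expr0 mulmx1; congr rowp; rewrite /shift_index addn0.
  by case: p.
rewrite exprSr mulmxA -IH /A mulmxA.
apply/rowP => j; rewrite mxE.
have -> : shift_index k.+1 p = shift_index 1 (shift_index k p).
  by rewrite /shift_index /= addn1 addnS.
rewrite hankel_entry_shift hankel_entry_factor; rewrite !mxE; apply: eq_bigr => i _; congr (_ * _).
by rewrite !mxE /= hankel_entry_shift.
Qed.

(** The powers of the state matrix are read off from shifted Hankel minors, so
    they tend to zero together with the Markov parameters. *)
Lemma state_matrix_pow k : A ^+ k = invmx M *m hankel_minor h (shift_index k \o f) g.
Proof.
have -> : hankel_minor h (shift_index k \o f) g = M *m A ^+ k.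
  apply/row_matrixP => i; rewrite row_mul.
  transitivity (rowp (shift_index k (f i))); first by apply/rowP => j; rewrite !mxE.
  rewrite hankel_row_shift; congr (_ *m _).
  by apply/rowP => j; rewrite !mxE.
by rewrite mulKmx.
Qed.

Lemma markov_realization k a b : h k.+1 a b =
  (rowp (0, a) *m A ^+ k *m (invmx M *m colp (0, b))) 0 0.
Proof.
have -> : h k.+1 a b = hankel_entry h (shift_index k (0, a)) (0, b).
  by rewrite /hankel_entry /= add0n addn0.
by rewrite hankel_entry_factor hankel_row_shift -!mulmxA.
Qed.

End realization.
End hankel_rank.

(** * Geometric decay of the Markov parameters and of their derivatives *)

Section matrix_functions.
Context {R : realType} {d : nat}.
Implicit Types (x : 'rV[R]_d).

Lemma differentiable_sumr x (I : Type) (r : seq I) (f : I -> 'rV[R]_d -> R) :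
  (forall i, differentiable (f i) x) ->
  differentiable (fun y => \sum_(i <- r) f i y) x.
Proof.
move=> df; elim: r => [|i r IH].
  rewrite (_ : (fun y => _) = cst 0); first exact: differentiable_cst.
  by apply/funext => y; rewrite big_nil.
rewrite (_ : (fun y => _) = (fun y => f i y + \sum_(j <- r) f j y)).
  exact: differentiableD.
by apply/funext => y; rewrite big_cons.
Qed.

Lemma differentiable_prodr x (I : Type) (r : seq I) (f : I -> 'rV[R]_d -> R) :
  (forall i, differentiable (f i) x) ->
  differentiable (fun y => \prod_(i <- r) f i y) x.
Proof.
move=> df; elim: r => [|i r IH].
  rewrite (_ : (fun y => _) = cst 1); first exact: differentiable_cst.
  by apply/funext => y; rewrite big_nil.
rewrite (_ : (fun y => _) = (fun y => f i y * \prod_(j <- r) f j y)).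
  exact: differentiableM.
by apply/funext => y; rewrite big_cons.
Qed.

Definition mx_differentiable n p (M : 'rV[R]_d -> 'M[R]_(n, p)) x :=
  forall i j, differentiable (fun y => M y i j) x.

Lemma mx_differentiable_mul n p q (M : 'rV[R]_d -> 'M[R]_(n, p))
    (N : 'rV[R]_d -> 'M[R]_(p, q)) x :
  mx_differentiable M x -> mx_differentiable N x ->
  mx_differentiable (fun y => M y *m N y) x.
Proof.
move=> dM dN i j.
rewrite (_ : (fun y => _) = (fun y => \sum_k M y i k * N y k j)).
  by apply: differentiable_sumr => k; apply: differentiableM.
by apply/funext => y; rewrite mxE.
Qed.

Lemma mx_differentiable_pow n (M : 'rV[R]_d -> 'M[R]_n) k x :
  mx_differentiable M x -> mx_differentiable (fun y => M y ^+ k) x.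
Proof.
move=> dM; elim: k => [|k IH].
  by move=> i j; under eq_fun do rewrite expr0; exact: differentiable_cst.
by under eq_fun do rewrite exprS; exact: mx_differentiable_mul.
Qed.

Lemma differentiable_det n (M : 'rV[R]_d -> 'M[R]_n) x :
  mx_differentiable M x -> differentiable (fun y => \det (M y)) x.
Proof.
move=> dM; rewrite /determinant.
apply: differentiable_sumr => s; apply: differentiableM.
  exact: differentiable_cst.
by apply: differentiable_prodr => i; exact: dM.
Qed.

Lemma mx_differentiable_inv n (M : 'rV[R]_d -> 'M[R]_n) x :
  mx_differentiable M x -> \det (M x) != 0 ->
  mx_differentiable (fun y => (\det (M y))^-1 *: \adj (M y)) x.
Proof.
move=> dM M0 i j.
rewrite (_ : (fun y => _) = (fun y => (\det (M y))^-1 * cofactor (M y) j i)).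
  apply: differentiableM.
    by apply: differentiableV => //; exact: differentiable_det.
  rewrite /cofactor; apply: differentiableM; first exact: differentiable_cst.
  apply: differentiable_det => a b.
  rewrite (_ : (fun y => _) = (fun y => M y (lift j a) (lift i b))); first exact: dM.
  by apply/funext => y; rewrite !mxE.
by apply/funext => y; rewrite !mxE.
Qed.

Lemma bernoulli_ge (e : R) n : 0 <= e <= 1 -> 1 - n%:R * e <= (1 - e) ^+ n.
Proof.
move=> /andP[e0 e1]; elim: n => [|n IH]; first by rewrite mul0r subr0 expr0.
have := ler_wpM2r (_ : 0 <= 1 - e) IH; rewrite subr_ge0 => /(_ e1).
rewrite exprSr; apply: le_trans; rewrite -[n.+1%:R]natr1.
have : 0 <= n%:R * e ^+ 2 by rewrite mulr_ge0// sqr_ge0.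
by move: (n%:R : R) => u; nra.
Qed.

(** As the powers of [A x] tend to zero, some power [A ^+ p] has small entries
    at [x], hence a small norm for every small weight [s]; submultiplicativity
    then gives geometric decay of the norms of all powers. *)
Lemma mx_powers_lipnorm n (A : 'rV[R]_d -> 'M[R]_n) x :
  mx_differentiable A x ->
  (forall i j, (fun k => (A x ^+ k) i j) @ \oo --> (0 : R)) ->
  exists K rho : R, [/\ 0 < K, 0 < rho < 1 & \forall s \near 0^'+, forall k i j,
    lipnorm_le x s (K * rho ^+ k) (fun y => (A y ^+ k) i j)].
Proof.
move=> dA A0.
(* an entry of a matrix product has [n] terms: with entries of norm at most
   [c0], multiplication by [A ^+ p] halves the norms *)
pose c0 : R := (2 * n.+1%:R)^-1.
have c00 : 0 < c0 by rewrite invr_gt0 mulr_gt0.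
have [p0 _ p0P] : \forall k \near \oo, forall ij : 'I_n * 'I_n,
    `|(A x ^+ k) ij.1 ij.2| < c0.
  apply: filter_forall => -[i j] /=.
  have /cvgrPdist_lt/(_ _ c00) := A0 i j.
  by apply: filterS => k; rewrite sub0r normrN.
pose p := p0.+1.
have pP i j : `|(A x ^+ p) i j| < c0.
  by have := p0P p (leqnSn p0) (i, j).
pose C : R := \sum_(b < p) `|A x ^+ b| + 1.
have C0 : 0 < C by rewrite ltr_wpDl// sumr_ge0.
have bC (b : 'I_p) i j : `|(A x ^+ b) i j| < C.
  rewrite (le_lt_trans (normr_coord_le _ i j))// /C (bigD1 b)//= -addrA.
  by rewrite ltrDl ltr_wpDl// sumr_ge0.
(* halving at every [p]-th step amounts to the ratio [rho], as [rho ^+ p] is at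
   least one half by Bernoulli's inequality *)
pose rho : R := 1 - (2 * p%:R)^-1.
have p2 : 0 < (2 * p%:R)^-1 :> R by rewrite invr_gt0 mulr_gt0.
have p2' : (2 * p%:R)^-1 <= 2^-1 :> R.
  by rewrite lef_pV2 ?posrE ?mulr_gt0// ler_pMr// ler1n.
have h1 : 2^-1 < 1 :> R by rewrite invf_lt1// ltr1n.
have rho01 : 0 < rho < 1.
  by rewrite /rho subr_gt0 (le_lt_trans p2')//= ltrBlDr ltrDl.
have rhop : 2^-1 <= rho ^+ p.
  apply: le_trans (bernoulli_ge p _); last first.
    by rewrite (ltW p2) (le_trans p2')// ltW.
  rewrite invfM mulrCA divff ?pnatr_eq0//.
  by rewrite mulr1 {2}[1]splitr div1r addrK.
have /andP[rho0 rho1] := rho01.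
have half_rho k : 2^-1 ^+ (k %/ p) <= 2 * rho ^+ k.
  rewrite [in leRHS](divn_eq k p) exprD mulnC exprM mulrCA.
  rewrite -[leLHS]mulr1; apply: ler_pM => //.
  - apply: lerXn2r; rewrite ?nnegrE//; exact: exprn_ge0 (ltW rho0).
  - rewrite -ler_pdivrMl// mulr1 (le_trans rhop)//.
    by rewrite ler_wiXn2l ?(ltW rho0) ?(ltW rho1)// ltnW// ltn_mod.
exists (2 * C), rho; split=> //; first by rewrite mulr_gt0.
have near_p : \forall s \near 0^'+, forall ij : 'I_n * 'I_n,
    lipnorm_le x s c0 (fun y => (A y ^+ p) ij.1 ij.2).
  apply: filter_forall => -[i j] /=; apply: differentiable_lipnorm => //.
  exact: mx_differentiable_pow.
have near_b : \forall s \near 0^'+, forall bij : 'I_p * ('I_n * 'I_n),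
    lipnorm_le x s C (fun y => (A y ^+ bij.1) bij.2.1 bij.2.2).
  apply: filter_forall => -[b [i j]] /=; apply: differentiable_lipnorm => //.
  exact: mx_differentiable_pow.
apply: filterS3 near_p near_b (nbhs_right_gt 0) => s sp sb s0.
have powC a (b : 'I_p) i j :
    lipnorm_le x s (C * 2^-1 ^+ a) (fun y => (A y ^+ (a * p + b)) i j).
  elim: a i j => [|a IH] i j.
    by rewrite expr0 mulr1; exact: (sb (b, (i, j))).
  rewrite (_ : (fun y => _) =
      (fun y => \sum_k (A y ^+ p) i k * (A y ^+ (a * p + b)) k j)); last first.
    by apply/funext => y; rewrite mulSn -addnA exprD mxE.
  apply: (@lipnorm_leW _ _ _ _ (\sum_(k < n) c0 * (C * 2^-1 ^+ a))); last first.
    apply: lipnorm_le_sum => // k; apply: lipnorm_leM => //.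
    exact: (sp (i, k)).
  rewrite sumr_const card_ord -[leLHS]mulr_natr exprS.
  rewrite (_ : c0 * _ * _ = C * ((c0 * n%:R) * 2^-1 ^+ a)); last by ring.
  rewrite ler_wpM2l ?(ltW C0)// ler_wpM2r ?exprn_ge0//.
  rewrite /c0 invfM -mulrA ler_piMr// ler_pdivrMl// mulr1 ler_nat//.
move=> k i j.
have := powC (k %/ p)%N (Ordinal (ltn_pmod k (ltn0Sn p0))) i j.
rewrite /= -divn_eq; apply: lipnorm_leW.
by rewrite [2 * C]mulrC -mulrA ler_wpM2l ?(ltW C0)// half_rho.
Qed.

End matrix_functions.

Section markov_parameter_bounds.
Context {R : realType} {m n d : nat}.
Variables (D : set 'rV[R]_d) (s : 'rV[R]_d -> linear_system R m).

(** Constancy of the McMillan degree keeps one invertible minor of the Hankel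
    matrix available near [x], and with it a realization whose matrices are
    rational functions of finitely many Markov parameters. *)
Lemma markov_param_lipnorm x : open D -> D x -> smooth_family D s ->
  (forall y, D y -> stochastic_linear_system (s y)) -> stable (s x) ->
  (forall y, D y -> mcmillan_degree (s y) n) ->
  exists rho : R, 0 < rho < 1 /\ forall a b, exists K : R,
    \forall r \near 0^'+, forall k,
      lipnorm_le x r (K * rho ^+ k) (fun y => markov_param (s y) k a b).
Proof.
move=> oD Dx sm sls st deg.
pose h y := markov_param (s y).
have dh k a b : differentiable (fun y => h y k a b) x.
  exact: markov_param_differentiable sm.
have h0 a b : (fun k => h x k a b) @ \oo --> (0 : R).
  by apply: stable_markov_param_cvg0 => //; exact: (sls x Dx).1.
have [k0 rk0] := (deg x Dx).2.
have [f [g MU]] := hankel_minor_unit (h x) k0.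
rewrite {}rk0 in f g MU.
pose M y := hankel_minor (h y) f g.
have dminor n1 n2 (f' : 'I_n1 -> nat * 'I_m) (g' : 'I_n2 -> nat * 'I_m) :
    mx_differentiable (fun y => hankel_minor (h y) f' g') x.
  move=> i j; rewrite (_ : (fun y => _) = (fun y => hankel_entry (h y) (f' i) (g' j))).
    exact: dh.
  by apply/funext => y; rewrite mxE.
have Mx0 : \det (M x) != 0 by rewrite -unitfE -unitmxE.
pose iM y := (\det (M y))^-1 *: \adj (M y).
have diM : mx_differentiable iM x by apply: mx_differentiable_inv => //; exact: dminor.
have iME y : \det (M y) != 0 -> invmx (M y) = iM y.
  by rewrite -unitfE -unitmxE /invmx => ->.
pose A y := iM y *m hankel_minor (h y) (shift_index 1 \o f) g.
have dA : mx_differentiable A x.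
  by apply: mx_differentiable_mul => //; exact: dminor.
have Apow i j : (fun k => (A x ^+ k) i j) @ \oo --> (0 : R).
  have -> : (fun k => (A x ^+ k) i j) = (fun k => \sum_l iM x i l *
      hankel_entry (h x) (shift_index k (f l)) (g j)).
    apply/funext => k; rewrite /A -iME// (state_matrix_pow (deg x Dx).1 MU).
    by rewrite mxE; apply: eq_bigr => l _; rewrite mxE.
  rewrite [X in _ --> X](_ : _ = \sum_l iM x i l * 0); last first.
    by rewrite big1// => l _; rewrite mulr0.
  apply: cvg_sumr => l; apply: cvgMl_tmp; rewrite /hankel_entry /=.
  have := h0 (f l).2 (g j).2; rewrite -(cvg_shiftn ((f l).1 + (g j).1).+1).
  apply: cvg_trans; apply: near_eq_cvg; near=> k.
  by rewrite /= addnS addnA (addnC k).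
have [K [rho [K0 rho01 nearA]]] := mx_powers_lipnorm dA Apow.
have /andP[rho0 rho1] := rho01.
exists rho; split=> // a b.
pose Cr y : 'rV[R]_n := hankel_minor (h y) (fun _ : 'I_1 => (0, a)%N) g.
pose Bc y : 'cV[R]_n := iM y *m hankel_minor (h y) f (fun _ : 'I_1 => (0, b)%N).
have dC : mx_differentiable Cr x by exact: dminor.
have dB : mx_differentiable Bc x.
  by apply: mx_differentiable_mul => //; exact: dminor.
have real y k : D y -> \det (M y) != 0 ->
    h y k.+1 a b = \sum_j (\sum_i Cr y 0 i * (A y ^+ k) i j) * Bc y j 0.
  move=> Dy My0.
  have MyU : M y \in unitmx by rewrite unitmxE unitfE.
  rewrite (markov_realization (deg y Dy).1 MyU) -/(M y) iME// -/(A y) mxE.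
  apply: eq_bigr => j _; congr (_ * _).
    by rewrite mxE; apply: eq_bigr => i _; rewrite !mxE.
pose K1 := \sum_j (\sum_i (`|Cr x 0 i| + 1) * K) * (`|Bc x j 0| + 1).
have K10 : 0 <= K1.
  by rewrite sumr_ge0// => j _; rewrite mulr_ge0 ?addr_ge0// sumr_ge0// => i _;
     rewrite mulr_ge0 ?addr_ge0// ltW.
(* [K1 / rho] accounts for the shift from [h k.+1] to [A ^+ k], the other
   summand for [h 0] *)
exists (K1 / rho + (`|h x 0%N a b| + 1)).
have near_good : \forall r \near 0^'+, forall u, `|u| < r ->
    D (u + x) /\ \det (M (u + x)) != 0.
  have : \forall y \near x, D y /\ \det (M y) != 0.
    apply: filterI; first exact: open_nbhs_nbhs.
    have : {for x, continuous (fun y => \det (M y))}.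
      apply: differentiable_continuous; exact: differentiable_det (dminor _ _ _ _).
    by move=> /cvgr_neq0; apply.
  move=> /nbhs_normP[r0 /= r00 B0]; near=> r => u ur; apply: B0.
  rewrite /ball_/= opprD addrCA subrr addr0 normrN (lt_le_trans ur)//.
  by near: r; apply: nbhs_right_le.
have near_C : \forall r \near 0^'+, forall i,
    lipnorm_le x r (`|Cr x 0 i| + 1) (fun y => Cr y 0 i).
  by apply: filter_forall => i; apply: differentiable_lipnorm => //; rewrite ltrDl.
have near_B : \forall r \near 0^'+, forall j,
    lipnorm_le x r (`|Bc x j 0| + 1) (fun y => Bc y j 0).
  by apply: filter_forall => i; apply: differentiable_lipnorm => //; rewrite ltrDl.
have near_h : \forall r \near 0^'+,
    lipnorm_le x r (`|h x 0%N a b| + 1) (fun y => h y 0%N a b).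
  by apply: differentiable_lipnorm => //; rewrite ltrDl.
near=> r.
have r0 : 0 < r by near: r; exact: nbhs_right_gt.
have hr0 : lipnorm_le x r (`|h x 0%N a b| + 1) (fun y => h y 0%N a b).
  by near: r.
have Cr0 : forall i, lipnorm_le x r (`|Cr x 0 i| + 1) (fun y => Cr y 0 i).
  by near: r.
have Br0 : forall j, lipnorm_le x r (`|Bc x j 0| + 1) (fun y => Bc y j 0).
  by near: r.
have Ar0 : forall k i j, lipnorm_le x r (K * rho ^+ k) (fun y => (A y ^+ k) i j).
  by near: r.
have gr : forall u, `|u| < r -> D (u + x) /\ \det (M (u + x)) != 0 by near: r.
case=> [|k].
  apply: lipnorm_leW hr0; rewrite expr0 mulr1 lerDr divr_ge0// ltW//.
apply: (@lipnorm_leW _ _ _ _ (K1 * rho ^+ k)).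
  rewrite mulrDl exprS mulrA divfK ?gt_eqF// lerDl.
  by rewrite mulr_ge0 ?addr_ge0 ?mulr_ge0 ?exprn_ge0// ltW.
apply: (lipnorm_le_local (f := fun y =>
  \sum_j (\sum_i Cr y 0 i * (A y ^+ k) i j) * Bc y j 0) r0).
  by move=> u /gr[Du Mu]; rewrite real.
rewrite /K1 mulr_suml.
apply: lipnorm_le_sum => // j; rewrite mulrAC; apply: lipnorm_leM => //.
rewrite mulr_suml; apply: lipnorm_le_sum => // i; rewrite -mulrA.
exact: lipnorm_leM.
Unshelve. all: by end_near. Qed.

End markov_parameter_bounds.

(** * Covariances of the output *)

Section mean_square.
Context {R : realType} {disp : measure_display} {T : measurableType disp}.
Variable P : probability T R.
Implicit Types f g h : T -> R.
Local Notation L1 := (Lfun P 1).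
Local Notation L2 := (Lfun P 2%:E).

Let le12 : (1 <= 2%:E :> \bar R)%E.
Proof. by rewrite lee_fin ler1n. Qed.

Lemma mem_Lfun2 f : measurable_fun setT f -> ('E_P[f \* f] < +oo)%E -> f \in L2.
Proof.
move=> mf; rewrite unlock => f2; rewrite inE; apply/andP; split; rewrite inE//=.
rewrite /finite_norm unlock /Lnorm poweR_lty//.
rewrite (_ : \int[P]_x _ = \int[P]_x (f x * f x)%:E)%E//.
apply: eq_integral => x _ /=.
by rewrite powR_mulrn// real_normK ?num_real.
Qed.

Lemma Lfun2D f g : f \in L2 -> g \in L2 -> (fun w => f w + g w) \in L2.
Proof.
move=> f2 g2; have := (Lfun_submod_closed P le12).2 1 f g f2 g2.
by rewrite scale1r.
Qed.

Lemma Lfun2Z (a : R) f : f \in L2 -> (fun w => a * f w) \in L2.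
Proof.
move=> f2; have [z cl] := Lfun_submod_closed P le12.
by have := cl a f 0 f2 z; rewrite addr0.
Qed.

Lemma Lfun2_0 : (fun _ : T => 0 : R) \in L2.
Proof. exact: (Lfun_submod_closed P le12).1. Qed.

Lemma Lfun2_sum (I : Type) (r : seq I) (F : I -> T -> R) :
  (forall i, F i \in L2) -> (fun w => \sum_(i <- r) F i w) \in L2.
Proof.
move=> F2; elim: r => [|i r IH].
  rewrite (_ : (fun w => _) = (fun=> 0)); first exact: Lfun2_0.
  by apply/funext => w; rewrite big_nil.
rewrite (_ : (fun w => _) = (fun w => F i w + \sum_(j <- r) F j w)).
  exact: Lfun2D.
by apply/funext => w; rewrite big_cons.
Qed.

Definition L2_inner f g : R := fine ('E_P[f \* g])%E.

Lemma ipC f g : L2_inner f g = L2_inner g f.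
Proof. by rewrite /L2_inner (_ : f \* g = g \* f)//; apply/funext => w /=; rewrite mulrC. Qed.

Lemma ipE f g : f \in L2 -> g \in L2 -> ('E_P[f \* g] = (L2_inner f g)%:E)%E.
Proof.
by move=> f2 g2; rewrite /L2_inner fineK// expectation_fin_num// Lfun2_mul_Lfun1.
Qed.

Lemma ipDl f g h : f \in L2 -> g \in L2 -> h \in L2 ->
  L2_inner (fun w => f w + g w) h = L2_inner f h + L2_inner g h.
Proof.
move=> f2 g2 h2; rewrite /L2_inner.
rewrite (_ : _ \* h = (f \* h) \+ (g \* h)).
  rewrite expectationD ?Lfun2_mul_Lfun1// fineD// expectation_fin_num//.
    exact: Lfun2_mul_Lfun1.
  exact: Lfun2_mul_Lfun1.
by apply/funext => w /=; rewrite mulrDl.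
Qed.

Lemma ipZl a f h : f \in L2 -> h \in L2 -> L2_inner (fun w => a * f w) h = a * L2_inner f h.
Proof.
move=> f2 h2; rewrite /L2_inner.
rewrite (_ : _ \* h = a \o* (f \* h)).
  by rewrite expectationZl ?Lfun2_mul_Lfun1// ipE.
by apply/funext => w /=; ring.
Qed.

Lemma ipDr f g h : f \in L2 -> g \in L2 -> h \in L2 ->
  L2_inner h (fun w => f w + g w) = L2_inner h f + L2_inner h g.
Proof. by move=> *; rewrite ipC ipDl// !(ipC h). Qed.

Lemma ipZr a f h : f \in L2 -> h \in L2 -> L2_inner h (fun w => a * f w) = a * L2_inner h f.
Proof. by move=> *; rewrite ipC ipZl// (ipC h). Qed.

Lemma ip0l h : L2_inner (fun=> 0) h = 0.
Proof.
rewrite /L2_inner (_ : _ \* h = cst 0) ?expectation_cst//.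
by apply/funext => w /=; rewrite mul0r.
Qed.

Lemma ip_suml (I : Type) (r : seq I) (F : I -> T -> R) h :
  (forall i, F i \in L2) -> h \in L2 ->
  L2_inner (fun w => \sum_(i <- r) F i w) h = \sum_(i <- r) L2_inner (F i) h.
Proof.
move=> F2 h2; elim: r => [|i r IH].
  rewrite big_nil -[RHS](ip0l h); congr L2_inner.
  by apply/funext => w; rewrite big_nil.
rewrite big_cons -IH -ipDl//; last exact: Lfun2_sum.
by congr L2_inner; apply/funext => w; rewrite big_cons.
Qed.

Lemma ip_sum (I J : Type) (r : seq I) (q : seq J) (a : I -> R) (b : J -> R)
    (F : I -> T -> R) (G : J -> T -> R) :
  (forall i, F i \in L2) -> (forall j, G j \in L2) ->
  L2_inner (fun w => \sum_(i <- r) a i * F i w) (fun w => \sum_(j <- q) b j * G j w) =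
  \sum_(i <- r) \sum_(j <- q) a i * b j * L2_inner (F i) (G j).
Proof.
move=> F2 G2.
have G2' : (fun w => \sum_(j <- q) b j * G j w) \in L2.
  by apply: Lfun2_sum => j; exact: Lfun2Z.
rewrite ip_suml//; last by move=> i; exact: Lfun2Z.
apply: eq_bigr => i _; rewrite ipZl// ipC ip_suml//; last by move=> j; exact: Lfun2Z.
by rewrite mulr_sumr; apply: eq_bigr => j _; rewrite ipZl// ipC mulrA.
Qed.

Lemma ip_ge0 f : 0 <= L2_inner f f.
Proof.
by rewrite /L2_inner fine_ge0// expectation_ge0// => w /=; rewrite -expr2 sqr_ge0.
Qed.

Lemma ip_cauchy_schwarz f g : f \in L2 -> g \in L2 ->
  `|L2_inner f g| <= Num.sqrt (L2_inner f f) * Num.sqrt (L2_inner g g).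
Proof.
move=> f2 g2.
have quad t : 0 <= L2_inner f f + 2 * t * L2_inner f g + t ^+ 2 * L2_inner g g.
  have := ip_ge0 (fun w => f w + t * g w).
  have tg2 := Lfun2Z t g2.
  have sum2 := Lfun2D f2 tg2.
  rewrite ipDl// !ipDr// !ipZr// !ipZl// (ipC g f).
  by congr (_ <= _); ring.
rewrite -sqrtrM ?ip_ge0// -sqrtr_sqr ler_wsqrtr//.
have a0 := ip_ge0 f; have c0 := ip_ge0 g.
move: quad a0 c0; set a := L2_inner f f; set b := L2_inner f g; set c := L2_inner g g => quad a0 c0.
have [c00|c00] := eqVneq c 0.
  (* if [c = 0], the quadratic is affine, and negative somewhere unless [b = 0] *)
  have [->|b0] := eqVneq b 0; first by rewrite expr0n/= mulr_ge0.
  have := quad (- (a + 1) / (2 * b)).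
  rewrite c00 mulr0 addr0 (_ : 2 * (- (a + 1) / (2 * b)) * b = - (a + 1)).
    by rewrite opprD addrA subrr sub0r oppr_ge0 ler10.
  by field.
(* the minimum of the quadratic *)
have := quad (- b / c).
rewrite (_ : a + _ + _ = a - b ^+ 2 / c); last by field.
by rewrite subr_ge0 ler_pdivrMr// lt_def c00.
Qed.

(** Bilinearity, in the form that compares the product of two approximations
    with the product of their limits. *)
Lemma ipBB f f' g g' : f \in L2 -> f' \in L2 -> g \in L2 -> g' \in L2 ->
  L2_inner (fun w => f w + (-1) * f' w) (fun w => g w + (-1) * g' w) =
  L2_inner f g - L2_inner f' g - L2_inner f g' + L2_inner f' g'.
Proof.
move=> f2 f'2 g2 g'2.
have nf := Lfun2Z (-1) f'2; have ng := Lfun2Z (-1) g'2.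
have sg := Lfun2D g2 ng.
by rewrite ipDl// !ipDr// !ipZr// !ipZl//; ring.
Qed.

Lemma ip_mean_square_cvg (X Y : T -> R) (U V : nat -> T -> R) :
  X \in L2 -> Y \in L2 -> (forall n, U n \in L2) -> (forall n, V n \in L2) ->
  (fun n => L2_inner (fun w => X w - U n w) (fun w => X w - U n w)) @ \oo --> (0 : R) ->
  (fun n => L2_inner (fun w => Y w - V n w) (fun w => Y w - V n w)) @ \oo --> (0 : R) ->
  (fun n => L2_inner (U n) (V n)) @ \oo --> L2_inner X Y.
Proof.
move=> X2 Y2 U2 V2 XU YV.
pose DX n w := X w - U n w; pose DY n w := Y w - V n w.
have L2B f g : f \in L2 -> g \in L2 -> (fun w => f w - g w) \in L2.
  move=> f2 g2; have := Lfun2D f2 (Lfun2Z (-1) g2).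
  by under eq_fun do rewrite mulN1r.
have DX2 n : DX n \in L2 by exact: L2B.
have DY2 n : DY n \in L2 by exact: L2B.
have E n : L2_inner (U n) (V n) =
    L2_inner X Y - L2_inner (DX n) Y - L2_inner X (DY n) + L2_inner (DX n) (DY n).
  have -> : U n = (fun w => X w + (-1) * DX n w).
    by apply/funext => w; rewrite /DX mulN1r opprB addrC subrK.
  have -> : V n = (fun w => Y w + (-1) * DY n w).
    by apply/funext => w; rewrite /DY mulN1r opprB addrC subrK.
  exact: ipBB.
have sq (W : nat -> T -> R) : (fun n => L2_inner (W n) (W n)) @ \oo --> (0 : R) ->
    (fun n => Num.sqrt (L2_inner (W n) (W n))) @ \oo --> (0 : R).
  by move=> W0; rewrite -[X in _ --> X]sqrtr0; apply: continuous_cvg W0; exact: sqrt_continuous.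
have sX := sq DX XU; have sY := sq DY YV.
have to0 (u v : nat -> R) : (forall n, `|u n| <= v n) -> v @ \oo --> (0 : R) ->
    u @ \oo --> (0 : R).
  move=> uv v0; apply/cvgrPdist_le => e e0.
  move/cvgrPdist_le : v0 => /(_ _ e0); apply: filterS => n.
  by rewrite !sub0r !normrN; apply: le_trans; rewrite (le_trans (uv n))// ler_norm.
rewrite (funext E).
rewrite [X in _ --> X](_ : _ = L2_inner X Y - 0 - 0 + 0); last by rewrite !subr0 addr0.
apply: cvgD; first apply: cvgB; first apply: cvgB.
- exact: cvg_cst.
- apply: (to0 _ (fun n => Num.sqrt (L2_inner (DX n) (DX n)) * Num.sqrt (L2_inner Y Y))).
    by move=> n; exact: ip_cauchy_schwarz.
  by rewrite -[X in _ --> X](mul0r (Num.sqrt (L2_inner Y Y))); apply: cvgMr_tmp.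
- apply: (to0 _ (fun n => Num.sqrt (L2_inner X X) * Num.sqrt (L2_inner (DY n) (DY n)))).
    by move=> n; exact: ip_cauchy_schwarz.
  by rewrite -[X in _ --> X](mulr0 (Num.sqrt (L2_inner X X))); apply: cvgMl_tmp.
- apply: (to0 _ (fun n => Num.sqrt (L2_inner (DX n) (DX n)) * Num.sqrt (L2_inner (DY n) (DY n)))).
    by move=> n; exact: ip_cauchy_schwarz.
  by rewrite -[X in _ --> X](mulr0 0); apply: cvgM.
Qed.

End mean_square.

Section output_covariance.
Context {R : realType} {m : nat} {disp : measure_display}
  {T : measurableType disp} (P : probability T R).
Variables (H : nat -> 'M[R]_m) (S : 'M[R]_m) (eps y : int -> 'I_m -> {RV P >-> R}).
Hypothesis eps_noise : gaussian_white_noise S eps.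
Hypothesis y_output : output_process H eps y.
Local Notation L2 := (Lfun P 2%:E).

Let partial t a n w := \sum_(i < n) \sum_(b < m) H i a b * eps (t - i%:Z) b w.

Let eps2 t a : (eps t a : T -> R) \in L2.
Proof.
apply: mem_Lfun2; first exact: measurable_funPT.
by have [_ -> _] := eps_noise; rewrite eqxx ltry.
Qed.

Let partialE t a n : partial t a n = (fun w => \sum_(p : 'I_n * 'I_m)
  H p.1 a p.2 * eps (t - (p.1 : nat)%:Z) p.2 w).
Proof. by apply/funext => w; rewrite /partial pair_bigA. Qed.

Let partial2 t a n : partial t a n \in L2.
Proof. by rewrite partialE; apply: Lfun2_sum => p; apply: Lfun2Z. Qed.

Let diff_ip t a n : 'E_P[(fun w => (y t a w - partial t a n w) ^+ 2)%R]%E =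
  'E_P[(fun w => y t a w - partial t a n w)%R \* (fun w => y t a w - partial t a n w)%R]%E.
Proof. by congr ('E_P[ _ ])%E. Qed.

Let diff2 t a : exists n, (fun w => y t a w - partial t a n w) \in L2.
Proof.
have /fine_cvgP[[n _ nP] _] := y_output t a.
exists n; apply: mem_Lfun2.
  apply: measurable_realfun.measurable_funB; first exact: measurable_funPT.
  by have := partial2 t a n; rewrite inE => /andP[+ _]; rewrite inE.
by have := nP n (leqnn n); rewrite diff_ip fin_numElt => /andP[].
Qed.

Let y2 t a : (y t a : T -> R) \in L2.
Proof.
have [n yn] := diff2 t a; have := Lfun2D yn (partial2 t a n).
by under eq_fun do rewrite subrK.
Qed.

Let y_cvg t a : (fun n => L2_inner P (fun w => y t a w - partial t a n w)
  (fun w => y t a w - partial t a n w)) @ \oo --> (0 : R).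
Proof.
have /fine_cvgP[_ c] := y_output t a.
by move: c; apply: cvg_trans; apply: near_eq_cvg; near=> n; rewrite /= diff_ip.
Unshelve. all: by end_near. Qed.

(** The covariances converge along the partial sums of the output, for which
    only the products of equal-time noise terms survive. *)
Lemma autocov_series t k a b :
  series (fun i => \sum_(c < m) \sum_(e < m) H i a c * S c e * H (i + k)%N b e)
    @ \oo --> autocov y t k a b.
Proof.
have -> : autocov y t k a b = L2_inner P (y t a) (y (t + k%:Z) b) by rewrite mxE.
(* [n + k] terms at time [t + k] reach back exactly as far as [n] terms at time
   [t], so every noise term of the latter meets its partner *)
have yc' : (fun n => L2_inner P
    (fun w => y (t + k%:Z) b w - partial (t + k%:Z) b (n + k)%N w)
    (fun w => y (t + k%:Z) b w - partial (t + k%:Z) b (n + k)%N w)) @ \oo --> (0 : R).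
  have := y_cvg (t + k%:Z) b; rewrite -(cvg_shiftn k).
  by apply.
have := ip_mean_square_cvg (y2 t a) (y2 (t + k%:Z) b) (partial2 t a)
  (fun n => partial2 (t + k%:Z) b (n + k)%N) (y_cvg t a) yc'.
rewrite (_ : (fun n => L2_inner P _ _) = series (fun i => \sum_(c < m) \sum_(e < m)
  H i a c * S c e * H (i + k)%N b e))//; apply/funext => n.
rewrite !partialE ip_sum//.
have [_ ee _] := eps_noise.
rewrite /series /= big_mkord -(pair_bigA _ (fun i c => \sum_(q : 'I_(n + k) * 'I_m)
  H (i : 'I_n) a c * H q.1 b q.2 * L2_inner P (eps (t - (i : nat)%:Z) c)
     (eps (t + k%:Z - (q.1 : nat)%:Z) q.2))) /=.
apply: eq_bigr => i _; apply: eq_bigr => c _.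
rewrite -(pair_bigA _ (fun j e => H i a c * H (j : 'I_(n + k)) b e *
  L2_inner P (eps (t - (i : nat)%:Z) c) (eps (t + k%:Z - (j : nat)%:Z) e))) /=.
have ik : (i + k < n + k)%N by rewrite ltn_add2r.
rewrite (bigD1 (Ordinal ik)) //= [X in _ + X]big1 ?addr0.
  apply: eq_bigr => e _; rewrite /L2_inner ee.
  rewrite (_ : t - _ == _); last by apply/eqP; rewrite PoszD; ring.
  by rewrite /= mulrAC.
move=> j ji; rewrite big1// => e _; rewrite /L2_inner ee ifN ?mulr0//.
apply: contra ji => /eqP E; apply/eqP/val_inj => /=.
by lia.
Qed.

End output_covariance.

(** * Decay of the covariances and differentiation of the spectral series *)

Section covariance_bounds.
Context {R : realType} {m d : nat}.
Variables (D : set 'rV[R]_d) (h : 'rV[R]_d -> nat -> 'M[R]_m)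
  (S : 'rV[R]_d -> 'M[R]_m) (Gam : 'rV[R]_d -> nat -> 'M[R]_m).

(** Entry [(k, a, b)] of the covariances is a series whose [i]-th term has norm
    of order [rho ^+ i * rho ^+ (i + k)]: the decay in [k] factors out. *)
Lemma covariance_lipnorm x (rho : R) : open D -> D x -> 0 < rho < 1 ->
  (forall a b, exists K : R, \forall r \near 0^'+, forall k,
     lipnorm_le x r (K * rho ^+ k) (fun y => h y k a b)) ->
  (forall a b, differentiable (fun y => S y a b) x) ->
  (forall y, D y -> forall k a b,
     series (fun i => \sum_(c < m) \sum_(e < m)
       h y i a c * S y c e * h y (i + k)%N b e) @ \oo --> Gam y k a b) ->
  forall a b, exists K : R, \forall r \near 0^'+, forall k,
    lipnorm_le x r (K * rho ^+ k) (fun y => Gam y k a b).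
Proof.
move=> oD Dx /andP[rho0 rho1] hK dS GamE a b.
have /choice[Ka KaP] c := hK a c.
have /choice[Kb KbP] e := hK b e.
pose K0 := \sum_(c < m) \sum_(e < m) Ka c * (`|S x c e| + 1) * Kb e.
exists (K0 * (1 - rho ^+ 2)^-1).
have near_D : \forall r \near 0^'+, forall u, `|u| < r -> D (u + x).
  have : \forall y \near x, D y by exact: open_nbhs_nbhs.
  move=> /nbhs_normP[r0 /= r00 B0]; near=> r => u ur; apply: B0.
  rewrite /ball_/= opprD addrCA subrr addr0 normrN (lt_le_trans ur)//.
  by near: r; apply: nbhs_right_le.
have near_S : \forall r \near 0^'+, forall ce : 'I_m * 'I_m,
    lipnorm_le x r (`|S x ce.1 ce.2| + 1) (fun y => S y ce.1 ce.2).
  by apply: filter_forall => ce; apply: differentiable_lipnorm => //; rewrite ltrDl.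
have near_a : \forall r \near 0^'+, forall c k,
    lipnorm_le x r (Ka c * rho ^+ k) (fun y => h y k a c).
  by apply: filter_forall => c; exact: KaP.
have near_b : \forall r \near 0^'+, forall e k,
    lipnorm_le x r (Kb e * rho ^+ k) (fun y => h y k b e).
  by apply: filter_forall => e; exact: KbP.
near=> r.
have r0 : 0 < r by near: r; exact: nbhs_right_gt.
have Dr : forall u, `|u| < r -> D (u + x) by near: r.
have Sr : forall ce : 'I_m * 'I_m,
    lipnorm_le x r (`|S x ce.1 ce.2| + 1) (fun y => S y ce.1 ce.2) by near: r.
have ar : forall c k, lipnorm_le x r (Ka c * rho ^+ k) (fun y => h y k a c).
  by near: r.
have br : forall e k, lipnorm_le x r (Kb e * rho ^+ k) (fun y => h y k b e).
  by near: r.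
move=> k.
have rho2 : `|rho ^+ 2| < 1.
  by rewrite ger0_norm ?exprn_ge0 ?(ltW rho0)// exprn_ilt1// ltW.
have /= gs := cvg_geometric_series (a := K0 * rho ^+ k) rho2.
rewrite mulrAC.
apply: (lipnorm_le_series (f := fun i y => \sum_(c < m) \sum_(e < m)
   h y i a c * S y c e * h y (i + k)%N b e) r0 gs _ _).1; last first.
  by move=> u ur; exact: GamE (Dr _ ur) _ _ _.
move=> i /=.
have -> : K0 * rho ^+ k * rho ^+ 2 ^+ i = \sum_(c < m) \sum_(e < m)
    (Ka c * rho ^+ i) * (`|S x c e| + 1) * (Kb e * rho ^+ (i + k)).
  rewrite /K0 !mulr_suml; apply: eq_bigr => c _; rewrite !mulr_suml.
  by apply: eq_bigr => e _; rewrite exprD -exprM mul2n -addnn exprD; ring.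
apply: lipnorm_le_sum => // c; apply: lipnorm_le_sum => // e.
apply: lipnorm_leM => //; apply: lipnorm_leM => //; exact: (Sr (c, e)).
Unshelve. all: by end_near. Qed.

End covariance_bounds.

Section spectral_series_derivative.
Context {R : realType} {m d : nat}.
Local Notation normc := (@ComplexField.Normc.normc R).
Implicit Types (z : R[i]) (u w : nat -> R).

Lemma normc_inv_pow z k : `|z| = 1 -> normc (z ^- k) = 1.
Proof.
move=> z1; apply: (@complexI R); rewrite -[LHS]normcE_C.
by rewrite normfV normrX z1 expr1n invr1.
Qed.

Lemma Re_inv_pow_le1 z k : `|z| = 1 -> `|complex.Re (z ^- k)| <= 1.
Proof. by move=> z1; rewrite -(normc_inv_pow k z1) Re_le_normc. Qed.

Lemma Im_inv_pow_le1 z k : `|z| = 1 -> `|complex.Im (z ^- k)| <= 1.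
Proof. by move=> z1; rewrite -(normc_inv_pow k z1) Im_le_normc. Qed.

Lemma Re_zseries u z n :
  complex.Re (zseries u z n) = series (fun k => complex.Re (z ^- k) * u k) n.
Proof.
rewrite /zseries /series /=; elim/big_rec2: _ => // k _ s _ <-.
case: s => p q /=; case: (z ^- k) => e f /=.
by rewrite mul0r subr0 mulrC.
Qed.

Lemma Im_zseries u z n :
  complex.Im (zseries u z n) = series (fun k => complex.Im (z ^- k) * u k) n.
Proof.
rewrite /zseries /series /=; elim/big_rec2: _ => // k _ s _ <-.
case: s => p q /=; case: (z ^- k) => e f /=.
by rewrite mul0r addr0 mulrC.
Qed.

Lemma zseries_cvgP u z l : zseries u z @ \oo --> (l : R[i]^o) <->
  series (fun k => complex.Re (z ^- k) * u k) @ \oo --> complex.Re l /\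
  series (fun k => complex.Im (z ^- k) * u k) @ \oo --> complex.Im l.
Proof.
have -> : series (fun k => complex.Re (z ^- k) * u k) =
    (fun n => complex.Re (zseries u z n)).
  by apply/funext => n; rewrite Re_zseries.
have -> : series (fun k => complex.Im (z ^- k) * u k) =
    (fun n => complex.Im (zseries u z n)).
  by apply/funext => n; rewrite Im_zseries.
exact: cvg_complexP.
Qed.

Lemma unit_mul_le (a b c : R) : `|a| <= 1 -> `|b| <= c -> `|a * b| <= c.
Proof.
move=> a1 bc; rewrite normrM (le_trans _ bc)// ler_piMl//.
Qed.

Lemma zseries_dominated_cvg u w z : `|z| = 1 -> (forall k, `|u k| <= w k) ->
  cvgn (series w) -> exists l : R[i], zseries u z @ \oo --> (l : R[i]^o).
Proof.
move=> z1 uw cw.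
have cr : cvgn (series (fun k => complex.Re (z ^- k) * u k)).
  apply: dominated_series_cvg cw => k; apply: unit_mul_le => //.
  exact: Re_inv_pow_le1.
have ci : cvgn (series (fun k => complex.Im (z ^- k) * u k)).
  apply: dominated_series_cvg cw => k; apply: unit_mul_le => //.
  exact: Im_inv_pow_le1.
exists (limn (series (fun k => complex.Re (z ^- k) * u k)) +i*
        limn (series (fun k => complex.Im (z ^- k) * u k)))%C.
by apply/zseries_cvgP.
Qed.

Variables (D : set 'rV[R]_d) (Gam : 'rV[R]_d -> nat -> 'M[R]_m).

(** On the unit circle the powers [z ^- k] do not change the norms of the
    terms, so the series may be differentiated termwise. *)
Lemma spectral_series_partial (x : 'rV[R]_d) (w : nat -> R) (r : R) a b z (i : 'I_d) :
  0 < r -> cvgn (series w) -> (forall h, `|h| < r -> D (h + x)) ->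
  (forall k, lipnorm_le x r (w k) (fun y => Gam y k a b)) ->
  (forall y, D y -> cvgn (zseries (fun k => Gam y k a b) z)) ->
  `|z| = 1 ->
  derivableC i (fun y => spectral_series Gam y z a b) x /\
  zseries (fun k => 'D_(delta_mx 0 i) (fun y => Gam y k a b) x) z @ \oo -->
    (partialC i (fun y => spectral_series Gam y z a b) x : R[i]^o).
Proof.
move=> r0 cw Dr Gw cz z1.
have limE y : D y -> zseries (fun k => Gam y k a b) z @ \oo -->
    (spectral_series Gam y z a b : R[i]^o).
  by move=> Dy; rewrite mxE; exact: cz Dy.
have wW : series w @ \oo --> limn (series w) by exact: cw.
have lipc (c : nat -> R) : (forall k, `|c k| <= 1) -> forall k,
    lipnorm_le x r (w k) (fun y => c k * Gam y k a b).
  move=> c1 k; apply: lipnorm_leW (lipnorm_leZ (c k) r0 (Gw k)).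
  by rewrite ler_piMl// (lipnorm_le_ge0 (Gw k)).
have [|dRe pRe] := lipnorm_le_series
    (F := fun y => complex.Re (spectral_series Gam y z a b))
    r0 wW (lipc _ (fun k => Re_inv_pow_le1 k z1)).
  by move=> u /Dr /limE /zseries_cvgP[].
have [|dIm pIm] := lipnorm_le_series
    (F := fun y => complex.Im (spectral_series Gam y z a b))
    r0 wW (lipc _ (fun k => Im_inv_pow_le1 k z1)).
  by move=> u /Dr /limE /zseries_cvgP[].
have dG k : derivable (fun y => Gam y k a b) x (delta_mx 0 i).
  by apply: diff_derivable; case: (Gw k).
split.
  by split; apply: diff_derivable; [case: dRe|case: dIm].
apply/zseries_cvgP; split.
- rewrite [series _](_ : _ = series (fun k => 'D_(delta_mx 0 i)
      (fun y => complex.Re (z ^- k) * Gam y k a b) x)); first exact: pRe.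
  by congr series; apply/funext => k; rewrite deriveZ.
- rewrite [series _](_ : _ = series (fun k => 'D_(delta_mx 0 i)
      (fun y => complex.Im (z ^- k) * Gam y k a b) x)); first exact: pIm.
  by congr series; apply/funext => k; rewrite deriveZ.
Qed.

End spectral_series_derivative.

(** * Metric tensors *)

Section metric_tensors.
Context {R : realType} {m d : nat}.
Variables (D : set 'rV[R]_d) (Gam : 'rV[R]_d -> nat -> 'M[R]_m) (x : 'rV[R]_d).
Hypothesis oD : open D.
Hypothesis Dx : D x.
Hypothesis dG : forall k a b, differentiable (fun y => Gam y k a b) x.

Definition cov_partial (i : 'I_d) k : 'M[R]_m :=
  \matrix_(a, b) 'D_(delta_mx 0 i) (fun y => Gam y k a b) x.

Lemma smooth_curve_derivable (c : R -> 'rV[R]_d) :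
  smooth_curve_through D x c -> derivable c 0 1.
Proof. by move=> [_ /nbhs_singleton[_ /(_ 0%N)]]. Qed.

(** The chain rule in coordinates: tangent vectors are the combinations of the
    coordinate derivatives with the components of the velocity. *)
Lemma tangent_vectorE (c : R -> 'rV[R]_d) : smooth_curve_through D x c ->
  tangent_vector Gam c (fun k => \sum_i (c^`())%classic 0 0 i *: cov_partial i k).
Proof.
move=> cx; have dc := smooth_curve_derivable cx; have [c0 _] := cx.
move=> k.
have dcd : differentiable c 0 by apply/derivable1_diffP.
have ent a b : is_derive (0 : R) 1 (fun t => Gam (c t) k a b)
    (\sum_i (c^`())%classic 0 0 i * cov_partial i k a b).
  pose f y := Gam y k a b.
  have df : differentiable f (c 0) by rewrite c0; exact: dG.
  have dfc : differentiable (f \o c) 0 by exact: differentiable_comp.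
  split; first exact/derivable1_diffP.
  rewrite (_ : (fun t => _) = f \o c)// deriveE// diff_comp//=.
  have -> : 'd c 0 1 = (c^`())%classic 0 by rewrite derive1E deriveE.
  rewrite c0.
  rewrite [in LHS](row_sum_delta ((c^`())%classic 0)) linear_sum.
  apply: eq_bigr => i _; rewrite linearZ/= -deriveE ?mxE//.
  by rewrite -c0.
have dM : derivable (fun t => Gam (c t) k) 0 1.
  apply/derivable_mxP => a b; have e := ent a b.
  exact: (@ex_derive _ _ _ _ _ _ _ e).
split=> //; rewrite derive_mx//; apply/matrixP => a b.
rewrite mxE summxE (@derive_val _ _ _ _ _ _ _ (ent a b)).
by apply: eq_bigr => i _; rewrite !mxE.
Qed.

Lemma coordinate_line (i : 'I_d) :
  let c := (fun t : R => t *: delta_mx 0 i + x : 'rV[R]_d) in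
  smooth_curve_through D x c /\ (c^`())%classic 0 = delta_mx 0 i.
Proof.
move=> c.
have ic (t : R) : is_derive t 1 c (delta_mx 0 i).
  by have := is_derive_line (@derivable_id _ _ (c t) (delta_mx 0 i)); rewrite derive_id.
have dc (t : R) : derivable c t 1 by have e := ic t; exact: (@ex_derive _ _ _ _ _ _ _ e).
have c1 : (c^`())%classic = cst (delta_mx 0 i).
  by apply/funext => t; rewrite derive1E (@derive_val _ _ _ _ _ _ _ (ic t)).
have ck k : (c^`(k.+2))%classic = cst 0.
  elim: k => [|k IH].
    by rewrite derive1nS derive1n1 c1; apply/funext => t; rewrite derive1_cst.
  by rewrite derive1nS IH; apply/funext => t; rewrite derive1_cst.
split; last by rewrite c1.
split; first by rewrite /c scale0r add0r.
have Dc : \forall t \near (0 : R), D (c t).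
  have cc : {for 0, continuous c}.
    by apply: differentiable_continuous; apply/derivable1_diffP.
  have : \forall y \near c 0, D y.
    by apply: open_nbhs_nbhs; split=> //; rewrite /c scale0r add0r.
  by move/cc.
apply: filterS Dc => t Dct; split=> // -[|[|k]].
- exact: dc.
- by rewrite derive1n1 c1; exact: derivable_cst.
- by rewrite ck; exact: derivable_cst.
Qed.

Variable g : 'M[R]_d.
Hypothesis gE : forall i j,
  series (fun k => \tr (cov_partial i k *m (cov_partial j k)^T)) @ \oo --> g i j.

Lemma metric_tensor_partials : metric_tensor D Gam x g.
Proof.
split.
  apply/matrixP => i j; rewrite mxE.
  have Eij : series (fun k => \tr (cov_partial j k *m (cov_partial i k)^T)) =
      series (fun k => \tr (cov_partial i k *m (cov_partial j k)^T)).
    by congr series; apply/funext => k; rewrite -mxtrace_tr trmx_mul trmxK.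
  have := @gE j i; rewrite Eij => gji.
  have e1 := cvg_lim (@Rhausdorff R) gji.
  have e2 := cvg_lim (@Rhausdorff R) (@gE i j).
  exact: etrans (esym (e1 _)) (e2 _).
move=> c1 c2 cx1 cx2.
exists (fun k => \sum_i (c1^`())%classic 0 0 i *: cov_partial i k).
exists (fun k => \sum_i (c2^`())%classic 0 0 i *: cov_partial i k).
split; [exact: tangent_vectorE|exact: tangent_vectorE|].
set v1 := (c1^`())%classic 0; set v2 := (c2^`())%classic 0.
have -> : (v1 *m g *m v2^T) 0 0 = \sum_i \sum_j v1 0 i * v2 0 j * g i j.
  rewrite mxE exchange_big; apply: eq_bigr => j _; rewrite !mxE mulr_suml.
  by apply: eq_bigr => i _; rewrite mulrAC.
have -> : inner_partial (fun k => \sum_i v1 0 i *: cov_partial i k)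
    (fun k => \sum_i v2 0 i *: cov_partial i k) =
    (fun n => \sum_i \sum_j v1 0 i * v2 0 j *
      series (fun k => \tr (cov_partial i k *m (cov_partial j k)^T)) n).
  apply/funext => n; rewrite /inner_partial /series /=.
  under [in RHS]eq_bigr do under eq_bigr do rewrite mulr_sumr.
  under [in RHS]eq_bigr do rewrite exchange_big /=.
  rewrite [RHS]exchange_big /=; apply: eq_bigr => k _.
  rewrite mulmx_suml raddf_sum; apply: eq_bigr => i _.
  rewrite linear_sum mulmx_sumr raddf_sum; apply: eq_bigr => j _.
  by rewrite linearZ/= -scalemxAl -scalemxAr !mxtraceZ mulrA.
apply: cvg_sumr => i; apply: cvg_sumr => j; apply: cvgMl_tmp; exact: gE.
Qed.

(** Testing a metric tensor on the coordinate lines determines its entries. *)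
Lemma metric_tensor_unique G : metric_tensor D Gam x G -> G = g.
Proof.
move=> [_ GP]; apply/matrixP => i j.
have [l1 d1] := coordinate_line i; have [l2 d2] := coordinate_line j.
have [s1 [s2 [t1 t2]]] := GP _ _ l1 l2.
rewrite d1 d2 => cG.
have sE (l : 'I_d) (c : R -> 'rV[R]_d) s : smooth_curve_through D x c ->
    (c^`())%classic 0 = delta_mx 0 l -> tangent_vector Gam c s -> s = cov_partial l.
  move=> ll dl ts; apply/funext => k.
  have e1 := ts k; have e2 := tangent_vectorE ll k.
  rewrite -(@derive_val _ _ _ _ _ _ _ e1) (@derive_val _ _ _ _ _ _ _ e2).
  rewrite dl (bigD1 l)//= big1 ?addr0 => [|i' i'l]; rewrite !mxE eqxx /=.
    by rewrite eqxx scale1r.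
  by rewrite (negbTE i'l) scale0r.
move: cG; rewrite (sE _ _ _ l1 d1 t1) (sE _ _ _ l2 d2 t2) => cG.
have e1 := cvg_lim (@Rhausdorff R) cG.
have e2 := cvg_lim (@Rhausdorff R) (@gE i j).
rewrite -(etrans (esym (e1 _)) (e2 _)).
rewrite -rowE trmx_delta -colE !mxE//.
Qed.

End metric_tensors.

(** * Integrals over a period *)

Section integrals_on_a_period.
Context {R : realType}.
Local Notation mu := (@lebesgue_measure R).
Local Notation period := [set` `[(0 : R), 2 * pi]].

Lemma period_gt0 : 0 < 2 * pi :> R.
Proof. by rewrite mulr_gt0// pi_gt0. Qed.

Lemma continuous_integrable_period (f : R -> R) : continuous f ->
  mu.-integrable period (EFin \o f).
Proof.
move=> cf; apply: continuous_compact_integrable; first exact: segment_compact.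
exact: continuous_subspaceT.
Qed.

Lemma Rintegral_period_cst (c : R) : \int[mu]_(t in period) c = c * (2 * pi).
Proof.
rewrite Rintegral_cst; last exact: measurable_itv.
have := @lebesgue_measure_itv R `[0, 2 * pi].
by rewrite /= lte_fin period_gt0 -EFinD subr0 => ->.
Qed.

Lemma continuous_sumr (I : Type) (r : seq I) (F : I -> R -> R) :
  (forall i, continuous (F i)) -> continuous (fun t => \sum_(i <- r) F i t).
Proof.
move=> cF; elim: r => [|i r IH].
  rewrite (_ : (fun t => _) = cst 0); first exact: cst_continuous.
  by apply/funext => t; rewrite big_nil.
rewrite (_ : (fun t => _) = (fun t => F i t + \sum_(j <- r) F j t)).
  by move=> t; apply: cvgD; [exact: cF|exact: IH].
by apply/funext => t; rewrite big_cons.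
Qed.

Lemma Rintegral_period_sum (I : Type) (r : seq I) (F : I -> R -> R) :
  (forall i, continuous (F i)) ->
  \int[mu]_(t in period) (\sum_(i <- r) F i t) =
  \sum_(i <- r) \int[mu]_(t in period) F i t.
Proof.
move=> cF; elim: r => [|i r IH].
  rewrite big_nil (_ : (fun t => _) = cst 0); last first.
    by apply/funext => t; rewrite big_nil.
  by rewrite Rintegral_period_cst mul0r.
rewrite big_cons -IH -RintegralD//.
- by congr (Rintegral _ _ _); apply/funext => t; rewrite big_cons.
- exact: continuous_integrable_period.
- by apply: continuous_integrable_period; exact: continuous_sumr.
Qed.

Lemma Rintegral_period_FTC (F f : R -> R) : (forall t : R, is_derive t 1 F (f t)) ->
  continuous f -> \int[mu]_(t in period) f t = F (2 * pi) - F 0.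
Proof.
move=> dF cf.
have dF' t : derivable F t 1 by have e := dF t; exact: (@ex_derive _ _ _ _ _ _ _ e).
have cF : continuous F.
  by move=> t; apply: differentiable_continuous; apply/derivable1_diffP.
rewrite /Rintegral (@continuous_FTC2 _ f F 0 (2 * pi) period_gt0) ?EFinB//.
- exact: continuous_subspaceT.
- split; first by move=> t _; exact: dF'.
    exact: (cvg_at_right_filter (cF 0)).
  exact: (cvg_at_left_filter (cF (2 * pi))).
- by move=> t _; rewrite derive1E; have e := dF t; exact: (@derive_val _ _ _ _ _ _ _ e).
Qed.

Lemma continuous_cosM (q : R) : continuous (fun t => cos (q * t)).
Proof.
by move=> t; apply: continuous_comp; [exact: mulrl_continuous|exact: continuous_cos].
Qed.

Lemma continuous_sinM (q : R) : continuous (fun t => sin (q * t)).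
Proof.
by move=> t; apply: continuous_comp; [exact: mulrl_continuous|exact: continuous_sin].
Qed.

Lemma is_derive_mull (q t : R) : is_derive t 1 ( *%R q) q.
Proof.
have := is_deriveZ q (is_derive_id t (1 : R)).
by rewrite /GRing.scale /= mulr1.
Qed.

Lemma period_shift (k l : nat) : (l%:R - k%:R) * (2 * pi) =
  - (0 + (pi *+ 2) *+ k) + (pi *+ 2) *+ l :> R.
Proof.
rewrite add0r -(mulr_natl _ k) -(mulr_natl _ l) -(mulr_natl pi 2); ring.
Qed.

Lemma cos_period (k l : nat) : cos ((l%:R - k%:R) * (2 * pi)) = 1 :> R.
Proof.
rewrite period_shift.
by rewrite (periodicn (@cosD2pi R)) cosN (periodicn (@cosD2pi R)) cos0.
Qed.

Lemma sin_period (k l : nat) : sin ((l%:R - k%:R) * (2 * pi)) = 0 :> R.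
Proof.
rewrite period_shift.
by rewrite (periodicn (@sinD2pi R)) sinN (periodicn (@sinD2pi R)) sin0 oppr0.
Qed.

Lemma Rintegral_cos_period (k l : nat) :
  \int[mu]_(t in period) cos ((l%:R - k%:R) * t) = if k == l then 2 * pi else 0.
Proof.
case: eqP => [->|/eqP kl].
  rewrite (_ : (fun t => _) = cst 1) ?Rintegral_period_cst ?mul1r//.
  by apply/funext => t; rewrite subrr mul0r cos0.
set q : R := l%:R - k%:R.
have q0 : q != 0 by rewrite subr_eq0 eqr_nat eq_sym.
have dF : forall t : R, is_derive t 1 (fun t => q^-1 * sin (q * t)) (cos (q * t)).
  move=> t; have d1 := is_derive_mull q t.
  have d2 : is_derive t 1 (fun t => sin (q * t)) (q * cos (q * t)).
    by have := is_derive1_comp (is_derive_sin (q * t)) d1; rewrite mulrC.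
  have := is_deriveZ q^-1 d2.
  by rewrite /GRing.scale/= mulrA mulVf// mul1r.
have -> := Rintegral_period_FTC dF (@continuous_cosM q).
by rewrite sin_period !mulr0 sin0 mulr0 subr0.
Qed.

Lemma Rintegral_sin_period (k l : nat) :
  \int[mu]_(t in period) sin ((l%:R - k%:R) * t) = 0.
Proof.
have [->|kl] := eqVneq k l.
  rewrite (_ : (fun t => _) = cst 0) ?Rintegral_period_cst ?mul0r//.
  by apply/funext => t; rewrite subrr mul0r sin0.
set q : R := l%:R - k%:R.
have q0 : q != 0 by rewrite subr_eq0 eqr_nat eq_sym.
have dF : forall t : R, is_derive t 1 (fun t => - q^-1 * cos (q * t)) (sin (q * t)).
  move=> t; have d1 := is_derive_mull q t.
  have d2 : is_derive t 1 (fun t => cos (q * t)) (q * - sin (q * t)).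
    by have := is_derive1_comp (is_derive_cos (q * t)) d1; rewrite mulrC.
  have := is_deriveZ (- q^-1) d2.
  by rewrite /GRing.scale/= mulrA mulNr mulVf// mulN1r opprK.
have -> := Rintegral_period_FTC dF (@continuous_sinM q).
by rewrite cos_period mulr0 cos0 subrr.
Qed.

(** Integrability of the limit comes from its continuity. *)
Lemma uniform_limit_Rintegral (f : R -> R) (fn : nat -> R -> R) (e : nat -> R) :
  (forall n, continuous (fn n)) -> (forall n t, `|f t - fn n t| <= e n) ->
  e @ \oo --> (0 : R) ->
  mu.-integrable period (EFin \o f) /\
  (fun n => \int[mu]_(t in period) fn n t) @ \oo --> \int[mu]_(t in period) f t.
Proof.
move=> cfn fe e0.
have cf : continuous f.
  move=> t; apply/cvgrPdist_le => r r0.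
  have r3 : 0 < r / 3 by rewrite divr_gt0.
  have [n _ /(_ n (leqnn n))] : \forall n \near \oo, e n <= r / 3.
    move/cvgrPdist_le : e0 => /(_ _ r3); apply: filterS => n.
    by rewrite sub0r normrN; apply: le_trans; exact: ler_norm.
  move=> en; have /cvgrPdist_le/(_ _ r3) := cfn n t.
  apply: filterS => s fs.
  rewrite (_ : f t - f s = (f t - fn n t) + (fn n t - fn n s) - (f s - fn n s)); last by ring.
  rewrite (le_trans (ler_normB _ _))// (_ : r = r / 3 + r / 3 + r / 3); last by field.
  rewrite lerD ?(le_trans (fe _ _))// (le_trans (ler_normD _ _))// lerD//.
  by rewrite (le_trans (fe _ _)).
have intf := continuous_integrable_period cf.
split=> //.
apply/cvgrPdist_le => r r0.
have r1 : 0 < r / (2 * pi) by rewrite divr_gt0// period_gt0.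
move/cvgrPdist_le : e0 => /(_ _ r1); apply: filterS => n.
rewrite sub0r normrN => en.
have cfd : continuous (fun t => f t - fn n t).
  by move=> t; apply: cvgB; [exact: cf|exact: cfn].
have intd := continuous_integrable_period cfd.
have intn := continuous_integrable_period (cfn n).
rewrite -RintegralB; [|exact: measurable_itv|exact: intf|exact: intn].
have := @le_normr_Rintegral _ _ _ _ _ _ _ intd.
move=> /(_ (measurable_itv _))/le_trans; apply.
apply: (@le_trans _ _ (\int[mu]_(t in period) e n)).
  apply: le_Rintegral; first exact: measurable_itv.
  - apply: (@continuous_integrable_period (fun t => `|f t - fn n t|)) => t.
    by apply: (continuous_comp (cfd t)); exact: norm_continuous.
  - by apply: continuous_integrable_period; exact: cst_continuous.
  - by move=> t _; exact: fe.
rewrite Rintegral_period_cst -ler_pdivlMr ?period_gt0//.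
by rewrite (le_trans (ler_norm _)).
Qed.

End integrals_on_a_period.

(** * Parseval's formula on the unit circle *)

Section parseval.
Context {R : realType}.
Local Notation normc := (@ComplexField.Normc.normc R).
Local Notation mu := (@lebesgue_measure R).
Local Notation period := [set` `[(0 : R), 2 * pi]].
Implicit Types (u v w : nat -> R) (z : R[i]).

Lemma expiD (a b : R) : expi (a + b) = expi a * expi b.
Proof.
by rewrite /expi cosD sinD; simpc; congr (_ +i* _);
   rewrite addrC mulrC [X in _ + X]mulrC.
Qed.

Lemma expi0 : expi 0 = 1 :> R[i].
Proof. by rewrite /expi cos0 sin0. Qed.

Lemma expiV (t : R) : (expi t)^-1 = expi (- t).
Proof.
have h : expi t * expi (- t) = 1 by rewrite -expiD subrr expi0.
have t0 : expi t != 0.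
  by apply/eqP => t0; move: h; rewrite t0 mul0r => /esym/eqP; rewrite oner_eq0.
by apply: (mulfI t0); rewrite h divff.
Qed.

Lemma expiX (t : R) k : expi t ^+ k = expi (k%:R * t).
Proof.
elim: k => [|k IH]; first by rewrite expr0 mul0r expi0.
by rewrite exprS IH -expiD -natr1 mulrDl mul1r addrC.
Qed.

Lemma norm_expi (t : R) : `|expi t| = 1.
Proof. by rewrite normcE_C /= cos2Dsin2 sqrtr1. Qed.

Lemma ReD (x y : R[i]) : complex.Re (x + y) = complex.Re x + complex.Re y.
Proof. by case: x y => [a b] [c e]. Qed.

Lemma ImD (x y : R[i]) : complex.Im (x + y) = complex.Im x + complex.Im y.
Proof. by case: x y => [a b] [c e]. Qed.

Lemma Re_sum (I : Type) (r : seq I) (F : I -> R[i]) :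
  complex.Re (\sum_(i <- r) F i) = \sum_(i <- r) complex.Re (F i).
Proof. exact: (big_morph _ ReD). Qed.

Lemma Im_sum (I : Type) (r : seq I) (F : I -> R[i]) :
  complex.Im (\sum_(i <- r) F i) = \sum_(i <- r) complex.Im (F i).
Proof. exact: (big_morph _ ImD). Qed.

(** The factor [2] adds the bounds for the real and the imaginary part. *)
Lemma zseries_tail u w W z (l : R[i]) n : `|z| = 1 -> (forall k, `|u k| <= w k) ->
  series w @ \oo --> W -> zseries u z @ \oo --> (l : R[i]^o) ->
  normc (l - zseries u z n) <= 2 * (W - series w n).
Proof.
move=> z1 uw wW /zseries_cvgP[lr li].
rewrite (le_trans (normc_le_ReIm _))// ReB ImB mulr2n mulrDl mul1r.
rewrite Re_zseries Im_zseries lerD//.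
- apply: (dominated_series_tail _ _ wW lr) => k; apply: unit_mul_le => //.
  exact: Re_inv_pow_le1.
- apply: (dominated_series_tail _ _ wW li) => k; apply: unit_mul_le => //.
  exact: Im_inv_pow_le1.
Qed.

Lemma zseries_product u v (t : R) n :
  zseries u (expi t) n * zseries v (expi t)^-1 n * 'i%C =
  \sum_(0 <= k < n) \sum_(0 <= l < n) (u k * v l)%:C *
    (- sin ((l%:R - k%:R) * t) +i* cos ((l%:R - k%:R) * t)).
Proof.
rewrite /zseries /series /= !mulr_suml; apply: eq_bigr => k _.
rewrite mulr_sumr mulr_suml; apply: eq_bigr => l _.
have -> : (- sin ((l%:R - k%:R) * t) +i* cos ((l%:R - k%:R) * t)) =
    expi ((l%:R - k%:R) * t) * 'i%C by rewrite /expi; simpc.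
have -> : expi t ^- k = expi (- (k%:R * t)) by rewrite expiX expiV.
have -> : (expi t)^-1 ^- l = expi (l%:R * t) by rewrite expiV expiX expiV mulrN opprK.
by rewrite mulrBl expiD rmorphM /=; ring.
Qed.

(** Integrating termwise the product of the series of [U j] at [z] and of
    [V j] at [z^-1] leaves the diagonal terms only, the others being integrals
    of nonconstant characters over a period. *)
Lemma circle_parseval (I : finType) (u v : I -> nat -> R) w (U V : I -> R[i] -> R[i])
    (f : R[i] -> R[i]) (L : R) :
  (forall j k, `|u j k| <= w k) -> (forall j k, `|v j k| <= w k) ->
  cvgn (series w) ->
  (forall j z, `|z| = 1 -> zseries (u j) z @ \oo --> (U j z : R[i]^o)) ->
  (forall j z, `|z| = 1 -> zseries (v j) z @ \oo --> (V j z : R[i]^o)) ->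
  (forall z, `|z| = 1 -> f z = (\sum_j U j z * V j z^-1) * z^-1) ->
  series (fun k => \sum_j u j k * v j k) @ \oo --> L ->
  circle_integrable f /\ circle_integral f = 0 +i* (2 * pi * L).
Proof.
move=> uw vw cw uU vV fE sL.
set W := limn (series w).
have wW : series w @ \oo --> W by exact: cw.
pose phi t := circle_pullback f t.
pose phin n t := \sum_j zseries (u j) (expi t) n * zseries (v j) (expi t)^-1 n * 'i%C.
have n1 t := norm_expi t.
have n1' t : `|(expi t)^-1| = 1 :> R[i] by rewrite expiV norm_expi.
have phiE t : phi t = \sum_j U j (expi t) * V j (expi t)^-1 * 'i%C.
  rewrite /phi /circle_pullback fE// -mulr_suml -mulrA; congr (_ * _).
  rewrite mulrCA mulVf ?mulr1//.
  by rewrite -normr_eq0 n1 oner_eq0.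
pose T n := W - series w n.
have T0 : T @ \oo --> (0 : R).
  by rewrite -(subrr W); apply: cvgB => //; exact: cvg_cst.
pose e n := #|I|%:R * (2 * `|T 0%N| * (2 * T n) + 2 * T n * (4 * `|T 0%N|)).
have tU j t n := zseries_tail n (n1 t) (uw j) wW (uU j _ (n1 t)).
have tV j t n := zseries_tail n (n1' t) (vw j) wW (vV j _ (n1' t)).
have z0 (x : nat -> R) z : zseries x z 0 = 0 :> R[i].
  by rewrite /zseries /series /= big_nil.
have err n t : normc (phi t - phin n t) <= e n.
  have ncs (F : I -> R[i]) : normc (\sum_j F j) <= \sum_j normc (F j).
    elim/big_rec2: _ => [|j x y _ xy]; first by rewrite ComplexField.Normc.normc0.
    by rewrite (le_trans (le_normcD _ _))// lerD2l.
  rewrite phiE /phin -sumrB (le_trans (ncs _))//.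
  rewrite /e mulr_natl -sumr_const; apply: ler_sum => j _.
  set z := expi t; set zV := z^-1.
  (* the partial sum of index [0] vanishes, so that the bound for the tails also
     bounds the sums themselves *)
  have -> : U j z * V j zV * 'i%C - zseries (u j) z n * zseries (v j) zV n * 'i%C =
      ((U j z - zseries (u j) z 0) * (V j zV - zseries (v j) zV n) +
       (U j z - zseries (u j) z n) * (V j zV - (V j zV - zseries (v j) zV n))) * 'i%C.
    by rewrite z0; ring.
  rewrite ComplexField.Normc.normcM [X in _ * X](_ : _ = 1) ?mulr1; last first.
    by rewrite /= expr0n expr1n add0r sqrtr1.
  have TT0 : 2 * T 0%N <= 2 * `|T 0%N| by rewrite ler_wpM2l// ler_norm.
  have nneg (x : R[i]) : 0 <= normc x by rewrite -lecR -normcE_C normr_ge0.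
  have Vn : normc (V j zV - (V j zV - zseries (v j) zV n)) <= 4 * `|T 0%N|.
    rewrite (le_trans (le_normcD _ _))//.
    rewrite (_ : 4 * `|T 0%N| = 2 * `|T 0%N| + 2 * `|T 0%N|); last by ring.
    have TV := tV j t 0%N; rewrite z0 subr0 in TV.
    apply: lerD; first exact: le_trans TV TT0.
    rewrite normcN (le_trans (tV j t n))// ler_wpM2l// (le_trans _ (ler_norm _))//.
    rewrite lerD2l lerN2 /series /= big_nil; apply: sumr_ge0 => k _.
    by rewrite (le_trans _ (uw j k)).
  rewrite (le_trans (le_normcD _ _))// !ComplexField.Normc.normcM lerD//.
    by apply: ler_pM => //; [exact: le_trans (tU j t 0%N) TT0|exact: tV].
  by apply: ler_pM => //; exact: tU.
have e0 : e @ \oo --> (0 : R).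
  rewrite [X in _ --> X](_ : _ =
    #|I|%:R * (2 * `|T 0%N| * (2 * 0) + 2 * 0 * (4 * `|T 0%N|))); last first.
    by rewrite !(mulr0, mul0r, addr0).
  apply: cvgMl_tmp; apply: cvgD.
    by apply: cvgMl_tmp; apply: cvgMl_tmp.
  by apply: cvgMr_tmp; apply: cvgMl_tmp.
pose c j k l := u j k * v j l.
have phinRe n t : complex.Re (phin n t) = \sum_j \sum_(0 <= k < n) \sum_(0 <= l < n)
    - c j k l * sin ((l%:R - k%:R) * t).
  rewrite /phin Re_sum; apply: eq_bigr => j _; rewrite zseries_product Re_sum.
  apply: eq_bigr => k _; rewrite Re_sum; apply: eq_bigr => l _ /=.
  by rewrite mul0r subr0 mulrN mulNr.
have phinIm n t : complex.Im (phin n t) = \sum_j \sum_(0 <= k < n) \sum_(0 <= l < n)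
    c j k l * cos ((l%:R - k%:R) * t).
  rewrite /phin Im_sum; apply: eq_bigr => j _; rewrite zseries_product Im_sum.
  apply: eq_bigr => k _; rewrite Im_sum; apply: eq_bigr => l _ /=.
  by rewrite mul0r addr0.
have cs (a q : R) : continuous (fun t => a * sin (q * t)).
  by move=> t; apply: cvgMl_tmp; exact: continuous_sinM.
have cc (a q : R) : continuous (fun t => a * cos (q * t)).
  by move=> t; apply: cvgMl_tmp; exact: continuous_cosM.
have [|||iRe cRe] := @uniform_limit_Rintegral R (fun t => complex.Re (phi t))
    (fun n t => complex.Re (phin n t)) e.
- move=> n; rewrite (funext (phinRe n)).
  apply: continuous_sumr => j; apply: continuous_sumr => k.
  apply: continuous_sumr => l; exact: cs.
- by move=> n t; rewrite -ReB (le_trans (Re_le_normc _)).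
- exact: e0.
have [|||iIm cIm] := @uniform_limit_Rintegral R (fun t => complex.Im (phi t))
    (fun n t => complex.Im (phin n t)) e.
- move=> n; rewrite (funext (phinIm n)).
  apply: continuous_sumr => j; apply: continuous_sumr => k.
  apply: continuous_sumr => l; exact: cc.
- by move=> n t; rewrite -ImB (le_trans (Im_le_normc _)).
- exact: e0.
split; first by split.
rewrite /circle_integral; congr (_ +i* _).
- rewrite -(cvg_lim _ cRe)// (_ : (fun n => _) = cst 0) ?lim_cst//.
  apply/funext => n; rewrite (funext (phinRe n)) Rintegral_period_sum; last first.
    move=> j; apply: continuous_sumr => k; apply: continuous_sumr => l; exact: cs.
  rewrite big1// => j _; rewrite Rintegral_period_sum; last first.
    by move=> k; apply: continuous_sumr => l; exact: cs.
  rewrite big1// => k _; rewrite Rintegral_period_sum; last first.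
    by move=> l; exact: cs.
  rewrite big1// => l _; rewrite RintegralZl.
  + by rewrite Rintegral_sin_period mulr0.
  + exact: measurable_itv.
  + by apply: continuous_integrable_period; exact: continuous_sinM.
- rewrite -(cvg_lim _ cIm)//; apply: cvg_lim => //.
  rewrite (_ : (fun n => _) = (fun n => 2 * pi *
      series (fun k => \sum_j u j k * v j k) n)); first exact: cvgMl_tmp.
  apply/funext => n; rewrite (funext (phinIm n)) Rintegral_period_sum; last first.
    move=> j; apply: continuous_sumr => k; apply: continuous_sumr => l; exact: cc.
  rewrite /series /= mulr_sumr; under [RHS]eq_bigr do rewrite mulr_sumr.
  rewrite [RHS]exchange_big /=; apply: eq_bigr => j _.
  rewrite Rintegral_period_sum; last first.
    by move=> k; apply: continuous_sumr => l; exact: cc.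
  apply: eq_big_nat => k /andP[_ kn]; rewrite Rintegral_period_sum; last first.
    by move=> l; exact: cc.
  rewrite big_mkord (bigD1 (Ordinal kn)) //= big1 ?addr0 => [|l lk].
    rewrite RintegralZl ?Rintegral_cos_period ?eqxx.
    + by rewrite mulrC.
    + exact: measurable_itv.
    + by apply: continuous_integrable_period; exact: continuous_cosM.
  rewrite RintegralZl ?Rintegral_cos_period.
  + by rewrite ifN ?mulr0// eq_sym.
  + exact: measurable_itv.
  + by apply: continuous_integrable_period; exact: continuous_cosM.
Qed.

End parseval.

(** * The theorem *)

Section output_covariance_family.
Context {R : realType} {d m n : nat}.
Variables (Theta : set 'rV[R]_d) (sys : 'rV[R]_d -> linear_system R m).
Hypotheses (Theta_open : open Theta)
  (sys_sls : forall x, Theta x -> stochastic_linear_system (sys x))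
  (sys_stable : forall x, Theta x -> stable (sys x))
  (sys_degree : forall x, Theta x -> mcmillan_degree (sys x) n)
  (sys_smooth : smooth_family Theta sys).
Variable Gam : 'rV[R]_d -> nat -> 'M[R]_m.
Hypothesis GamE : forall y, Theta y -> forall k a b,
  series (fun i => \sum_(c < m) \sum_(e < m) markov_param (sys y) i a c *
    noise_cov (sys y) c e * markov_param (sys y) (i + k)%N b e) @ \oo --> Gam y k a b.

(** There are finitely many entries, so one radius, one constant and one rate
    serve for all of them. *)
Lemma covariance_geometric_bound x : Theta x ->
  exists r C rho : R, [/\ 0 < r, 0 < rho < 1,
    forall h, `|h| < r -> Theta (h + x) &
    forall k a b, lipnorm_le x r (C * rho ^+ k) (fun y => Gam y k a b)].
Proof.
move=> Tx.
have [rho [rho01 hK]] := markov_param_lipnorm Theta_open Tx sys_smooth sys_sls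
  (sys_stable Tx) sys_degree.
have dS a b : differentiable (fun y => noise_cov (sys y) a b) x.
  exact: class_C1_differentiable Theta_open (sys_smooth.2 a b 1%N) Tx.
have GK a b := covariance_lipnorm Theta_open Tx rho01 hK dS GamE a b.
have /choice[K KP] : forall ab : 'I_m * 'I_m, exists K : R,
    \forall r \near 0^'+, forall k,
      lipnorm_le x r (K * rho ^+ k) (fun y => Gam y k ab.1 ab.2).
  by move=> ab; exact: GK.
have near_G : \forall r \near 0^'+, forall ab : 'I_m * 'I_m, forall k,
    lipnorm_le x r (K ab * rho ^+ k) (fun y => Gam y k ab.1 ab.2).
  by apply: filter_forall => ab; exact: KP.
have : \forall y \near x, Theta y by exact: open_nbhs_nbhs.
move=> /nbhs_normP[r0 /= r00 B0].
near (0 : R)^'+ => r.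
have rgt0 : 0 < r by near: r; exact: nbhs_right_gt.
exists r, (\sum_ab `|K ab|), rho; split=> //.
- move=> h hr; apply: B0; rewrite /ball_/= opprD addrCA subrr addr0 normrN.
  by rewrite (lt_le_trans hr)//; near: r; exact: nbhs_right_le.
- have rG : forall ab : 'I_m * 'I_m, forall k,
    lipnorm_le x r (K ab * rho ^+ k) (fun y => Gam y k ab.1 ab.2) by near: r.
  move=> k a b; apply: lipnorm_leW (rG (a, b) k).
  have /andP[rho0 _] := rho01.
  rewrite ler_wpM2r ?exprn_ge0 ?(ltW rho0)// (bigD1 (a, b))//=.
  by rewrite (le_trans (ler_norm _))// lerDl sumr_ge0.
Unshelve. all: by end_near. Qed.

Lemma covariance_spectral_cvg x z a b : Theta x -> `|z| = 1 ->
  cvgn (zseries (fun k => Gam x k a b) z).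
Proof.
move=> Tx z1.
have [r [C [rho [r0 /andP[rho0 rho1] _ GC]]]] := covariance_geometric_bound Tx.
have [l lP] : exists l : R[i], zseries (fun k => Gam x k a b) z @ \oo --> (l : R[i]^o).
  apply: (zseries_dominated_cvg (w := geometric C rho) z1).
    by move=> k; case: (GC k a b).
  by apply: is_cvg_geometric_series; rewrite gtr0_norm.
by apply/cvg_ex; exists l.
Qed.

End output_covariance_family.

Theorem theorem5 (R : realType) (d m n : nat)
    (Theta : set 'rV[R]_d) (sys : 'rV[R]_d -> linear_system R m)
    (Theta_open : open Theta)
    (sys_inj : forall x y, Theta x -> Theta y -> sys x = sys y -> x = y)
    (sys_sls : forall x, Theta x -> stochastic_linear_system (sys x))
    (sys_stable : forall x, Theta x -> stable (sys x))
    (sys_degree : forall x, Theta x -> mcmillan_degree (sys x) n)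
    (sys_smooth : smooth_family Theta sys)
    (disp : measure_display) (Omega : 'rV[R]_d -> measurableType disp)
    (P : forall x, probability (Omega x) R)
    (eps y : forall x, int -> 'I_m -> {RV (P x) >-> R})
    (eps_noise : forall x, Theta x ->
       gaussian_white_noise (noise_cov (sys x)) (eps x))
    (y_output : forall x, Theta x ->
       output_process (markov_param (sys x)) (eps x) (y x))
    (t : int) (Gam : 'rV[R]_d -> nat -> 'M[R]_m)
    (Gam_def : forall x i, Theta x -> Gam x i = autocov (y x) t i)
    (theta : 'rV[R]_d) (theta_in : Theta theta) :
  [/\ forall x z a b, Theta x -> `|z| = 1 ->
        cvgn (zseries (fun k => Gam x k a b) z),
      forall (i : 'I_d) z a b, `|z| = 1 ->
        derivableC i (fun x => spectral_series Gam x z a b) theta,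
      exists G, metric_tensor Theta Gam theta G &
      forall G, metric_tensor Theta Gam theta G -> forall i j : 'I_d,
        circle_integrable (metric_integrand Gam theta i j) /\
        (G i j)%:C = (2 * pi%:C * 'i%C)^-1 *
                     circle_integral (metric_integrand Gam theta i j)].
Proof.
have GamE y0 : Theta y0 -> forall k a b,
    series (fun i => \sum_(c < m) \sum_(e < m) markov_param (sys y0) i a c *
      noise_cov (sys y0) c e * markov_param (sys y0) (i + k)%N b e) @ \oo -->
    Gam y0 k a b.
  move=> Ty k a b; rewrite Gam_def//.
  exact: autocov_series (eps_noise y0 Ty) (y_output y0 Ty) t k a b.
have cz := covariance_spectral_cvg Theta_open sys_sls sys_stable sys_degree
  sys_smooth GamE.
have [r [C [rho [r0 /andP[rho0 rho1] Tr GC]]]] := covariance_geometric_bound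
  Theta_open sys_sls sys_stable sys_degree sys_smooth GamE theta_in.
have cw : cvgn (series (geometric C rho)).
  by apply: is_cvg_geometric_series; rewrite gtr0_norm.
have sp i z a b z1 := spectral_series_partial i r0 cw Tr
  (fun k => GC k a b) (fun y0 Ty => cz y0 z a b Ty z1) z1.
have dG k a b : differentiable (fun y0 => Gam y0 k a b) theta by case: (GC k a b).
pose p := cov_partial Gam theta.
pose C' := C / r.
have pC i k a b : `|p i k a b| <= geometric C' rho k.
  rewrite mxE (le_trans (lipnorm_le_partial i r0 (GC k a b)))//.
  by rewrite /C' /= mulrAC.
have trE i j k : \tr (p i k *m (p j k)^T) =
    \sum_(ab : 'I_m * 'I_m) p i k ab.1 ab.2 * p j k ab.1 ab.2.
  rewrite /mxtrace -(pair_bigA _ (fun a b => p i k a b * p j k a b)) /=.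
  apply: eq_bigr => a _; rewrite [LHS]mxE; apply: eq_bigr => b _.
  by congr (_ * _); rewrite [LHS]mxE.
pose g : 'M[R]_d := \matrix_(i, j) limn (series (fun k => \tr (p i k *m (p j k)^T))).
have gE i j : series (fun k => \tr (p i k *m (p j k)^T)) @ \oo --> g i j.
  rewrite mxE.
  pose w k := \sum_(ab : 'I_m * 'I_m) geometric (C' ^+ 2) (rho ^+ 2) k.
  apply: (@dominated_series_cvg _ _ w).
    move=> k; rewrite trE (le_trans (ler_norm_sum _ _ _))//; apply: ler_sum => ab _.
    rewrite normrM /= exprAC -exprMn expr2; exact: ler_pM.
  have -> : w = geometric (C' ^+ 2 *+ #|{: 'I_m * 'I_m}|) (rho ^+ 2).
    by apply/funext => k; rewrite /w sumr_const /= mulrnAl.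
  apply: is_cvg_geometric_series.
  by rewrite ger0_norm ?exprn_ge0 ?(ltW rho0)// exprn_ilt1// ltW.
split.
- by move=> x z a b Tx z1; exact: cz.
- by move=> i z a b z1; exact: (sp i z a b z1).1.
- by exists g; apply: metric_tensor_partials.
move=> G GP i j.
have -> : G = g by apply: (metric_tensor_unique Theta_open theta_in) GP.
have u_cvg (l : 'I_d) (ab : 'I_m * 'I_m) z : `|z| = 1 ->
    zseries (fun k => p l k ab.1 ab.2) z @ \oo -->
    (partialC l (fun y0 => spectral_series Gam y0 z ab.1 ab.2) theta : R[i]^o).
  move=> z1; have [_] := sp l z ab.1 ab.2 z1.
  rewrite (_ : (fun k => p l k ab.1 ab.2) = (fun k =>
    'D_(delta_mx 0 l) (fun y0 => Gam y0 k ab.1 ab.2) theta))//.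
  by apply/funext => k; rewrite mxE.
have cw' : cvgn (series (geometric C' rho)).
  by apply: is_cvg_geometric_series; rewrite gtr0_norm.
have fE z : `|z| = 1 -> metric_integrand Gam theta i j z =
    (\sum_(ab : 'I_m * 'I_m)
      partialC i (fun y0 => spectral_series Gam y0 z ab.1 ab.2) theta *
      partialC j (fun y0 => spectral_series Gam y0 z^-1 ab.1 ab.2) theta) * z^-1.
  move=> _; rewrite /metric_integrand; congr (_ * _).
  rewrite /mxtrace -(pair_bigA _ (fun a b =>
    partialC i (fun y0 => spectral_series Gam y0 z a b) theta *
    partialC j (fun y0 => spectral_series Gam y0 z^-1 a b) theta)) /=.
  apply: eq_bigr => a _; rewrite [LHS]mxE; apply: eq_bigr => b _.
  congr (_ * _); rewrite [LHS]mxE//.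
  by congr partialC; apply/funext => y0; rewrite mxE.
have sE : series (fun k => \sum_(ab : 'I_m * 'I_m)
    p i k ab.1 ab.2 * p j k ab.1 ab.2) @ \oo --> g i j.
  rewrite (_ : (fun k => _) = (fun k => \tr (p i k *m (p j k)^T))); first exact: gE.
  by apply/funext => k; rewrite trE.
have [ci ->] := circle_parseval (fun ab k => pC i k ab.1 ab.2)
  (fun ab k => pC j k ab.1 ab.2) cw' (u_cvg i) (u_cvg j) fE sE.
split=> //.
have -> : 0 +i* (2 * pi * g i j) = (2 * pi%:C * 'i%C) * (g i j)%:C :> R[i].
  by rewrite -(rmorph_nat (real_complex R)) -rmorphM; simpc.
rewrite mulKf// !mulf_neq0//.
  by rewrite -(rmorph0 (real_complex R)) (inj_eq (@complexI R)) gt_eqF// pi_gt0.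
by rewrite eq_complex /= oner_eq0 andbF.
Qed.
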